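(* Let $E$ be any graph and $K$ any field. Then in $L_K(E)$ $$I(P_{ec}(E))=\bigoplus_{\tilde c\in X_{ec}}I(\tilde c^0),$$ and every $I(\tilde c^0)$ is isomorphic to a Leavitt path algebra which is purely infinite simple.
   Context: A directed graph is $E=(E^0,E^1,r,s)$ with vertex set $E^0$, edge set $E^1$ and range and source maps $r,s:E^1\to E^0$. A vertex $v$ is regular if $s^{-1}(v)$ is finite and nonempty. The Leavitt path algebra $L_K(E)$ is the $K$-algebra generated by $E^0\cup E^1\cup\{e^*: e\in E^1\}$ with relations: $vw=\delta_{v,w}v$ for $v,w\in E^0$; $s(e)e=er(e)=e$ and $r(e)e^*=e^*s(e)=e^*$ for $e\in E^1$; $e^*e'=\delta_{e,e'}r(e)$ for $e,e'\in E^1$; and $v=\sum_{s(e)=v}ee^*$ for every regular $v$. $I(Y)$ is the two-sided ideal generated by a set $Y$ of vertices. Write $v\ge w$ if there is a path from $v$ to $w$; $T(Y)=\{w: v\ge w\text{ for some }v\in Y\}$. A cycle is a path $c=e_1\dots e_n$ ($n\ge1$) with $s(c)=r(c)$ and $s(e_i)\ne s(e_j)$ for $i\neq j$; $c^0$ is its set of vertices. An exit of $c$ is an edge $e$ with $s(e)=s(e_i)$, $e\neq e_i$ for some $i$. A cycle $c$ is extreme if it has exits and for every path $\lambda$ starting at a vertex of $c^0$ there is a path $\mu$ with $s(\mu)=r(\lambda)$ and $r(\mu)\in c^0$. $P_{ec}(E)$ is the set of vertices in extreme cycles. Extreme cycles $c,d$ are equivalent iff $T(c^0)\cap d^0\neq\emptyset$;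 $X_{ec}$ is the set of equivalence classes $\tilde c$, and $\tilde c^0$ is the set of all vertices of cycles in $\tilde c$. A simple ring $R$ (with local units) is purely infinite simple if every nonzero right ideal of $R$ contains an infinite idempotent, i.e. an idempotent $e$ such that $eR$ is isomorphic to a proper direct summand of itself. *)

(* Defs.v *)
From HB Require Import structures.
From mathcomp Require Import all_boot all_order all_algebra.
From mathcomp Require Import finmap.
From mathcomp Require Import boolp classical_sets functions cardinality fsbigop.

Set Implicit Arguments.
Unset Strict Implicit.
Unset Printing Implicit Defensive.

Import GRing.Theory.
Local Open Scope classical_set_scope.
Local Open Scope ring_scope.

HB.mixin Record Zmodule_isRng R of GRing.Zmodule R := {
  rngmul : R -> R -> R;
  rngmulA : associative rngmul;
  rngmulDl : left_distributive rngmul +%R;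
  rngmulDr : right_distributive rngmul +%R
}.

#[short(type="rngType")]
HB.structure Definition Rng := {R of Zmodule_isRng R & GRing.Zmodule R}.

Notation "x ** y" := (rngmul x y) (at level 40, left associativity) : ring_scope.

HB.mixin Record Rng_isRalg (K : fieldType) R of Rng R & GRing.Lmodule K R := {
  rngscaleAl : forall (a : K) (x y : R), a *: (x ** y) = (a *: x) ** y;
  rngscaleAr : forall (a : K) (x y : R), a *: (x ** y) = x ** (a *: y)
}.

#[short(type="ralgType")]
HB.structure Definition Ralg (K : fieldType) :=
  {R of Rng_isRalg K R & Rng R & GRing.Lmodule K R}.

Section RingTheory.
Variable R : rngType.
Implicit Types (J A B : set R) (e x y r : R).

(* Ideals are ring ideals: additive subgroups, with no stability under scalars
   required. For an algebra with local units, scalar stability is automatic. *)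
Definition additive_subgroup J :=
  J 0 /\ forall x y, J x -> J y -> J (x - y).

Definition right_ideal J :=
  additive_subgroup J /\ forall x r, J x -> J (x ** r).

Definition two_sided_ideal J :=
  right_ideal J /\ forall x r, J x -> J (r ** x).

Definition ideal_gen (Y : set R) : set R :=
  [set x | forall J, two_sided_ideal J -> Y `<=` J -> J x].

Definition has_local_units :=
  forall S : set R, finite_set S ->
    exists e, e ** e = e /\ forall x, S x -> e ** x = x /\ x ** e = x.

Definition simple_rng :=
  (exists x y : R, x ** y <> 0) /\
  forall J, two_sided_ideal J -> J = [set 0] \/ J = setT.

Definition principal_right e : set R := range (fun r => e ** r).

Definition right_direct_sum (M A B : set R) :=
  [/\ right_ideal A, right_ideal B, A `&` B = [set 0] &
      M = [set x + y | x in A & y in B]].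

(* Only the values of the isomorphism [f] on [A] matter. *)
Definition right_module_iso A B :=
  exists f : R -> R,
    [/\ {in A &, {morph f : x y / x + y}},
        forall x r, A x -> f (x ** r) = f x ** r &
        set_bij A B f].

Definition infinite_idempotent e :=
  e ** e = e /\
  exists A B, [/\ right_direct_sum (principal_right e) A B,
                  A <> principal_right e &
                  right_module_iso (principal_right e) A].

Definition purely_infinite_simple :=
  [/\ has_local_units, simple_rng &
      forall J, right_ideal J -> J <> [set 0] ->
        exists2 e, J e & infinite_idempotent e].

(* The summation map is a bijection onto [J] from the finitely supported
   families [(f i)_(i in X)] with [f i] in [F i]; such a family is extended by
   [0] outside of [X]. *)
Definition internal_direct_sum (I : choiceType) (X : set I) (F : I -> set R)
    (J : set R) :=
  set_bij
    [set f : I -> R | [/\ finite_set [set i | f i <> 0],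
                          forall i, X i -> F i (f i) &
                          forall i, ~ X i -> f i = 0]]
    J (fun f => \sum_(i \in X) f i).

End RingTheory.

Definition ralg_iso_onto (K : fieldType) (A B : ralgType K) (J : set B) :=
  exists f : {linear A -> B},
    {morph f : x y / x ** y} /\ set_bij setT J f.

Inductive ralg_term (K X : Type) :=
| tgen of X
| tzero
| tadd of ralg_term K X & ralg_term K X
| tscale of K & ralg_term K X
| tmul of ralg_term K X & ralg_term K X.
Arguments tgen {K X}.
Arguments tzero {K X}.

HB.instance Definition _ K X := gen_eqMixin (ralg_term K X).
HB.instance Definition _ K X := gen_choiceMixin (ralg_term K X).

Section Presentation.
Variables (K : fieldType) (X : Type).
Variable rel : ralg_term K X -> ralg_term K X -> Prop.
Local Notation term := (ralg_term K X).
Implicit Types (a b : K) (x y z : term).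

Inductive ralg_cong : term -> term -> Prop :=
| cong_rel x y : rel x y -> ralg_cong x y
| cong_refl x : ralg_cong x x
| cong_sym x y : ralg_cong x y -> ralg_cong y x
| cong_trans x y z : ralg_cong x y -> ralg_cong y z -> ralg_cong x z
| cong_add x x' y y' : ralg_cong x x' -> ralg_cong y y' ->
    ralg_cong (tadd x y) (tadd x' y')
| cong_scale a x x' : ralg_cong x x' -> ralg_cong (tscale a x) (tscale a x')
| cong_mul x x' y y' : ralg_cong x x' -> ralg_cong y y' ->
    ralg_cong (tmul x y) (tmul x' y')
| cong_addA x y z : ralg_cong (tadd x (tadd y z)) (tadd (tadd x y) z)
| cong_addC x y : ralg_cong (tadd x y) (tadd y x)
| cong_add0 x : ralg_cong (tadd tzero x) x
| cong_addN x : ralg_cong (tadd (tscale (-1) x) x) tzero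
| cong_scaleA a b x : ralg_cong (tscale a (tscale b x)) (tscale (a * b) x)
| cong_scale1 x : ralg_cong (tscale 1 x) x
| cong_scaleDr a x y :
    ralg_cong (tscale a (tadd x y)) (tadd (tscale a x) (tscale a y))
| cong_scaleDl a b x :
    ralg_cong (tscale (a + b) x) (tadd (tscale a x) (tscale b x))
| cong_mulA x y z : ralg_cong (tmul x (tmul y z)) (tmul (tmul x y) z)
| cong_mulDl x y z : ralg_cong (tmul (tadd x y) z) (tadd (tmul x z) (tmul y z))
| cong_mulDr x y z : ralg_cong (tmul x (tadd y z)) (tadd (tmul x y) (tmul x z))
| cong_scaleAl a x y : ralg_cong (tscale a (tmul x y)) (tmul (tscale a x) y)
| cong_scaleAr a x y : ralg_cong (tscale a (tmul x y)) (tmul x (tscale a y)).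

Definition ralg_congb x y := `[< ralg_cong x y >].

Lemma ralg_congb_refl : reflexive ralg_congb.
Proof. by move=> x; apply/asboolP; exact: cong_refl. Qed.

Lemma ralg_congb_sym : symmetric ralg_congb.
Proof. by move=> x y; apply/asboolP/asboolP; exact: cong_sym. Qed.

Lemma ralg_congb_trans : transitive ralg_congb.
Proof.
move=> y x z /asboolP xy /asboolP yz.
by apply/asboolP; exact: cong_trans xy yz.
Qed.

Canonical ralg_congb_equiv :=
  EquivRel ralg_congb ralg_congb_refl ralg_congb_sym ralg_congb_trans.

Definition presented := {eq_quot ralg_congb}%qT.

HB.instance Definition _ := Choice.on presented.

Definition prs_class (x : term) : presented := (\pi_{eq_quot ralg_congb} x)%qT.
Definition prs_repr (u : presented) : term := repr u.

Lemma prs_classP x y : prs_class x = prs_class y <-> ralg_cong x y.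
Proof.
split=> [/eqmodP/asboolP //|xy].
by apply/eqmodP/asboolP.
Qed.

Lemma prs_reprK : cancel prs_repr prs_class.
Proof. exact: reprK. Qed.

Lemma prs_reprP x : ralg_cong (prs_repr (prs_class x)) x.
Proof. by apply/prs_classP; rewrite prs_reprK. Qed.

Lemma prs_ind (P : presented -> Prop) :
  (forall x, P (prs_class x)) -> forall u, P u.
Proof. by move=> Px u; rewrite -[u]prs_reprK. Qed.

Definition prs_add u v := prs_class (tadd (prs_repr u) (prs_repr v)).
Definition prs_scale a u := prs_class (tscale a (prs_repr u)).
Definition prs_mul u v := prs_class (tmul (prs_repr u) (prs_repr v)).

Lemma prs_addE x y :
  prs_add (prs_class x) (prs_class y) = prs_class (tadd x y).
Proof. by apply/prs_classP/cong_add; exact: prs_reprP. Qed.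

Lemma prs_scaleE a x : prs_scale a (prs_class x) = prs_class (tscale a x).
Proof. by apply/prs_classP/cong_scale; exact: prs_reprP. Qed.

Lemma prs_mulE x y :
  prs_mul (prs_class x) (prs_class y) = prs_class (tmul x y).
Proof. by apply/prs_classP/cong_mul; exact: prs_reprP. Qed.

Lemma prs_addA : associative prs_add.
Proof.
elim/prs_ind=> x; elim/prs_ind=> y; elim/prs_ind=> z.
by rewrite !prs_addE; apply/prs_classP/cong_addA.
Qed.

Lemma prs_addC : commutative prs_add.
Proof.
elim/prs_ind=> x; elim/prs_ind=> y.
by rewrite !prs_addE; apply/prs_classP/cong_addC.
Qed.

Lemma prs_add0 : left_id (prs_class tzero) prs_add.
Proof. by elim/prs_ind=> x; rewrite prs_addE; apply/prs_classP/cong_add0. Qed.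

Lemma prs_addN : left_inverse (prs_class tzero) (prs_scale (-1)) prs_add.
Proof.
by elim/prs_ind=> x; rewrite prs_scaleE prs_addE; apply/prs_classP/cong_addN.
Qed.

HB.instance Definition _ :=
  GRing.isZmodule.Build presented prs_addA prs_addC prs_add0 prs_addN.

Lemma prs_scaleA a b u : prs_scale a (prs_scale b u) = prs_scale (a * b) u.
Proof.
by elim/prs_ind: u => x; rewrite !prs_scaleE; apply/prs_classP/cong_scaleA.
Qed.

Lemma prs_scale1 : left_id 1 prs_scale.
Proof.
by elim/prs_ind=> x; rewrite prs_scaleE; apply/prs_classP/cong_scale1.
Qed.

Lemma prs_scaleDr : right_distributive prs_scale +%R.
Proof.
move=> a; elim/prs_ind=> x; elim/prs_ind=> y.
rewrite /GRing.add /= !(prs_addE, prs_scaleE).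
by apply/prs_classP/cong_scaleDr.
Qed.

Lemma prs_scaleDl u : {morph prs_scale^~ u : a b / a + b}.
Proof.
move=> a b; elim/prs_ind: u => x; rewrite /= !prs_scaleE.
rewrite [RHS]prs_addE.
by apply/prs_classP/cong_scaleDl.
Qed.

HB.instance Definition _ := GRing.Zmodule_isLmodule.Build K presented
  prs_scaleA prs_scale1 prs_scaleDr prs_scaleDl.

Lemma prs_mulA : associative prs_mul.
Proof.
elim/prs_ind=> x; elim/prs_ind=> y; elim/prs_ind=> z.
by rewrite !prs_mulE; apply/prs_classP/cong_mulA.
Qed.

Lemma prs_mulDl : left_distributive prs_mul +%R.
Proof.
elim/prs_ind=> x; elim/prs_ind=> y; elim/prs_ind=> z.
rewrite /GRing.add /= !(prs_addE, prs_mulE).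
by apply/prs_classP/cong_mulDl.
Qed.

Lemma prs_mulDr : right_distributive prs_mul +%R.
Proof.
elim/prs_ind=> x; elim/prs_ind=> y; elim/prs_ind=> z.
rewrite /GRing.add /= !(prs_addE, prs_mulE).
by apply/prs_classP/cong_mulDr.
Qed.

HB.instance Definition _ :=
  Zmodule_isRng.Build presented prs_mulA prs_mulDl prs_mulDr.

Lemma prs_scaleAl a (u v : presented) : a *: (u ** v) = (a *: u) ** v.
Proof.
elim/prs_ind: u => x; elim/prs_ind: v => y.
rewrite /GRing.scale /rngmul /= !(prs_scaleE, prs_mulE).
by apply/prs_classP/cong_scaleAl.
Qed.

Lemma prs_scaleAr a (u v : presented) : a *: (u ** v) = u ** (a *: v).
Proof.
elim/prs_ind: u => x; elim/prs_ind: v => y.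
rewrite /GRing.scale /rngmul /= !(prs_scaleE, prs_mulE).
by apply/prs_classP/cong_scaleAr.
Qed.

HB.instance Definition _ :=
  Rng_isRalg.Build K presented prs_scaleAl prs_scaleAr.

End Presentation.

Record graph := Graph {
  vertex : Type;
  edge : Type;
  src : edge -> vertex;
  tgt : edge -> vertex
}.

HB.instance Definition _ (E : graph) := gen_eqMixin (vertex E).
HB.instance Definition _ (E : graph) := gen_choiceMixin (vertex E).
HB.instance Definition _ (E : graph) := gen_eqMixin (edge E).
HB.instance Definition _ (E : graph) := gen_choiceMixin (edge E).

Section Graphs.
Variable E : graph.
Implicit Types (u v w : vertex E) (e : edge E) (p q c d : seq (edge E)).

Definition out_edges v : set (edge E) := [set e | src e = v].

Definition regular v := finite_set (out_edges v) /\ out_edges v !=set0.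

(* [p] is a path from [v] to [w]; the empty sequence is the trivial path. *)
Fixpoint is_path v p w : Prop :=
  if p is e :: p' then src e = v /\ is_path (tgt e) p' w else v = w.

Definition tree (Y : set (vertex E)) : set (vertex E) :=
  [set w | exists2 v, Y v & exists p, is_path v p w].

Definition cycle_vertices c : set (vertex E) := [set` map (@src E) c].

Definition is_cycle c :=
  [/\ c <> [::], exists v, is_path v c v & uniq (map (@src E) c)].

Definition is_exit c e := exists2 e', e' \in c & src e = src e' /\ e <> e'.

Definition extreme_cycle c :=
  [/\ is_cycle c, exists e, is_exit c e &
      forall v p w, cycle_vertices c v -> is_path v p w ->
        exists q u, is_path w q u /\ cycle_vertices c u].

Definition P_ec : set (vertex E) :=
  [set v | exists2 c, extreme_cycle c & cycle_vertices c v].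

Definition ec_equiv c d := tree (cycle_vertices c) `&` cycle_vertices d !=set0.

(* [ec_equiv] is an equivalence relation on extreme cycles only. *)
Definition ec_class c : set (seq (edge E)) :=
  [set d | extreme_cycle d /\ ec_equiv c d].

Definition X_ec : set (set (seq (edge E))) :=
  [set ec_class c | c in extreme_cycle].

Definition class_vertices (C : set (seq (edge E))) : set (vertex E) :=
  \bigcup_(c in C) cycle_vertices c.

End Graphs.

Arguments P_ec : clear implicits.
Arguments X_ec : clear implicits.

Inductive lpa_gen (E : graph) :=
| gvertex of vertex E
| gedge of edge E
| gghost of edge E.

Section Leavitt.
Variables (K : fieldType) (E : graph).
Local Notation term := (ralg_term K (lpa_gen E)).
Implicit Types (v w : vertex E) (e : edge E).
Let V v : term := tgen (gvertex v).
Let D e : term := tgen (gedge e).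
Let G e : term := tgen (gghost e).

(* In [lpa_CK2] the enumeration order of the finite set [out_edges v] is
   immaterial, since [tadd] is commutative modulo [ralg_cong]. *)
Inductive lpa_rel : term -> term -> Prop :=
| lpa_vertex v w : lpa_rel (tmul (V v) (V w)) (if v == w then V v else tzero)
| lpa_src_edge e : lpa_rel (tmul (V (src e)) (D e)) (D e)
| lpa_edge_tgt e : lpa_rel (tmul (D e) (V (tgt e))) (D e)
| lpa_tgt_ghost e : lpa_rel (tmul (V (tgt e)) (G e)) (G e)
| lpa_ghost_src e : lpa_rel (tmul (G e) (V (src e))) (G e)
| lpa_CK1 e e' :
    lpa_rel (tmul (G e) (D e')) (if e == e' then V (tgt e) else tzero)
| lpa_CK2 v : regular v ->
    lpa_rel (V v)
      (\big[@tadd K (lpa_gen E)/tzero]_(e <- fset_set (out_edges v))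
         tmul (D e) (G e)).

Definition LPA : ralgType K := presented lpa_rel.

Definition lpa_vtx v : LPA := prs_class lpa_rel (V v).

Definition vertex_ideal (Y : set (vertex E)) : set LPA :=
  ideal_gen (lpa_vtx @` Y).

End Leavitt.

Arguments lpa_vtx K {E} v.
Arguments vertex_ideal K {E} Y.

(* Main.v *)
Require Import Defs.
From HB Require Import structures.
From mathcomp Require Import all_boot all_order all_algebra finmap.
From mathcomp Require Import boolp classical_sets functions cardinality fsbigop.

(* The vertices of the class of an extreme cycle [c] are those reachable from
   [c]; they form a hereditary, strongly connected set [H], and distinct classes
   give disjoint sets.  The ideal [I(H)] is the Leavitt path algebra of the
   hedgehog graph, obtained by adding to the part of [E] inside [H] one source,
   with a single edge, for every path that meets [H] only at its end.

   In the algebra of such a graph every [x <> 0] satisfies [a x b = h] for a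
   branching vertex [h] of [c]: multiplying by edges on the right removes the
   ghost edges, multiplying by the ghost of a shortest path leaves a nonzero
   multiple of a vertex plus closed paths, and conjugating by a path that
   leaves a closed path kills it.  Simplicity follows at once; pure infiniteness
   follows since [h] is an infinite idempotent and [x b h a] is an idempotent
   equivalent to it.  Vertices are nonzero because the algebra acts on functions
   on boundary paths.

   Ideals of distinct classes annihilate each other and have local units, so
   their sum is direct. *)

Set Implicit Arguments.
Unset Strict Implicit.
Unset Printing Implicit Defensive.

Import GRing.Theory.
Local Open Scope classical_set_scope.
Local Open Scope ring_scope.

(** * Rings without unit: ideals and infinite idempotents *)

Section RngTheory.
Variable R : rngType.
Implicit Types (J : set R) (x y z e s t : R).

Lemma rngmul0r x : 0 ** x = 0.
Proof. by apply: (addIr (0 ** x)); rewrite -rngmulDl !add0r. Qed.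

Lemma rngmulr0 x : x ** 0 = 0.
Proof. by apply: (addIr (x ** 0)); rewrite -rngmulDr !add0r. Qed.

Lemma rngmulNr x y : (- x) ** y = - (x ** y).
Proof. by apply: (addIr (x ** y)); rewrite -rngmulDl !addNr rngmul0r. Qed.

Lemma rngmulrN x y : x ** (- y) = - (x ** y).
Proof. by apply: (addIr (x ** y)); rewrite -rngmulDr !addNr rngmulr0. Qed.

Lemma rngmulBl x y z : (x - y) ** z = x ** z - y ** z.
Proof. by rewrite rngmulDl rngmulNr. Qed.

Lemma rngmulBr x y z : x ** (y - z) = x ** y - x ** z.
Proof. by rewrite rngmulDr rngmulrN. Qed.

Lemma rngmul_suml (I : Type) (r : seq I) (P : pred I) (F : I -> R) x :
  (\sum_(i <- r | P i) F i) ** x = \sum_(i <- r | P i) F i ** x.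
Proof.
by rewrite (big_morph (fun y => y ** x) (fun y z => rngmulDl y z x) (rngmul0r x)).
Qed.

Lemma rngmul_sumr (I : Type) (r : seq I) (P : pred I) (F : I -> R) x :
  x ** (\sum_(i <- r | P i) F i) = \sum_(i <- r | P i) x ** F i.
Proof.
by rewrite (big_morph (fun y => x ** y) (fun y z => rngmulDr x y z) (rngmulr0 x)).
Qed.

(** Turns a product identity into a rewriting rule for products associated to the right. *)
Lemma rngmulAeq x y t : x ** y = t -> forall z, x ** (y ** z) = t ** z.
Proof. by move=> <- z; rewrite rngmulA. Qed.

Lemma additive_subgroupN J x : additive_subgroup J -> J x -> J (- x).
Proof. by case=> J0 JB Jx; rewrite -sub0r; apply: JB. Qed.

Lemma additive_subgroupD J x y :
  additive_subgroup J -> J x -> J y -> J (x + y).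
Proof.
move=> aJ Jx Jy; rewrite -[y]opprK; apply: (proj2 aJ) => //.
exact: additive_subgroupN.
Qed.

Lemma additive_subgroup_sum J (I : eqType) (r : seq I) (F : I -> R) :
  additive_subgroup J -> (forall i, i \in r -> J (F i)) ->
  J (\sum_(i <- r) F i).
Proof.
move=> aJ JF; rewrite big_seq; apply: (big_ind J) => //; first exact: (proj1 aJ).
by move=> x y; exact: additive_subgroupD.
Qed.

Lemma ideal_gen_ideal (Y : set R) : two_sided_ideal (ideal_gen Y).
Proof.
split; first split; first split.
- by move=> J [[[]]].
- by move=> x y Jx Jy J JJ YJ; apply: (proj2 (proj1 (proj1 JJ)));
    [exact: Jx|exact: Jy].
- by move=> x r Jx J JJ YJ; apply: (proj2 (proj1 JJ)); exact: Jx.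
- by move=> x r Jx J JJ YJ; apply: (proj2 JJ); exact: Jx.
Qed.

Lemma sub_ideal_gen (Y : set R) : Y `<=` ideal_gen Y.
Proof. by move=> x Yx J _; exact. Qed.

Lemma ideal_gen_sub (Y J : set R) :
  two_sided_ideal J -> Y `<=` J -> ideal_gen Y `<=` J.
Proof. by move=> JJ YJ x; exact. Qed.

Lemma principal_right_ideal e : right_ideal (principal_right e).
Proof.
split; first split; first by exists 0 => //; exact: rngmulr0.
- by move=> _ _ [x _ <-] [y _ <-]; exists (x - y) => //; rewrite rngmulBr.
- by move=> _ r [x _ <-]; exists (x ** r) => //; rewrite rngmulA.
Qed.

(* Left multiplication by [s] maps [e R] isomorphically onto the summand
   [s t R]. *)
Lemma infinite_idempotent_criterion e s t :
  e ** e = e -> e ** s = s -> s ** e = s -> e ** t = t -> t ** e = t ->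
  t ** s = e -> s ** t <> e -> infinite_idempotent e.
Proof.
move=> ee es se et te ts nst; split=> //.
have stst x : s ** t ** (s ** t ** x) = s ** t ** x.
  by rewrite -!rngmulA (rngmulA t s) ts (rngmulA e) et.
exists (principal_right (s ** t)), (principal_right (e - s ** t)); split.
- split; try exact: principal_right_ideal.
  + apply/seteqP; split=> [x [[a _ <-] [b _ abE]]|_ ->].
      rewrite /= -(stst a) -abE rngmulBl rngmulBr stst.
      by rewrite [_ ** (e ** b)]rngmulA -(rngmulA s t e) te subrr.
    by split; exists 0; rewrite ?rngmulr0.
  + apply/seteqP; split=> [_ [a _ <-]|_ [_ [a _ <-]] [_ [b _ <-]] <-].
      exists (s ** t ** a); first by exists a.
      exists ((e - s ** t) ** a); first by exists a.
      by rewrite rngmulBl addrC subrK.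
    exists (s ** t ** a + (e - s ** t) ** b) => //.
    by rewrite rngmulDr !rngmulA rngmulBr !rngmulA es ee.
- move=> AE; have [r _ rE] : principal_right (s ** t) e by rewrite AE; exists e.
  by apply: nst; rewrite -te rngmulA -rE stst.
exists (rngmul s); split.
- by move=> x y _ _; rewrite rngmulDr.
- by move=> x r _; rewrite rngmulA.
split.
- move=> _ [r _ <-]; exists (s ** r) => //=.
  by rewrite -!rngmulA (rngmulA t s) ts.
- move=> x y /set_mem[a _ <-] /set_mem[b _ <-] /(congr1 (rngmul t)).
  by rewrite !rngmulA ts ee.
- by move=> _ [r _ <-]; exists (t ** r); [exists (t ** r); rewrite ?rngmulA ?et|rewrite rngmulA].
Qed.

(** If [a ** x ** b = w], then [x ** b ** w ** a] is an idempotent of the right ideal generated by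
    [x]. The elements [x ** b ** s ** a] and [x ** b ** t ** a] inherit the relations between [s],
    [t] and [w], so it is infinite too. *)
Lemma right_ideal_infinite_idempotent w s t :
  w ** w = w -> w ** s = s -> s ** w = s -> w ** t = t -> t ** w = t ->
  t ** s = w -> s ** t <> w ->
  (forall x, x <> 0 -> exists a b, a ** x ** b = w) ->
  forall J, right_ideal J -> J <> [set 0] -> exists2 e, J e & infinite_idempotent e.
Proof.
move=> ww ws sw wt tw ts nst red J JJ Jn0.
have [x Jx xn0] : exists2 x, J x & x <> 0.
  apply: contrapT => Jx; apply: Jn0; apply/seteqP; split=> [x Jx'|_ ->].
    by apply: contrapT => xn0; apply: Jx; exists x.
  by case: JJ => [[]].
have [a [b axb]] := red x xn0.
have axbm y : a ** (x ** (b ** y)) = w ** y by rewrite !rngmulA axb.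
exists (x ** b ** w ** a); first by rewrite -!rngmulA; exact: (proj2 JJ).
have axb' : a ** (x ** b) = w by rewrite rngmulA.
have wwm := rngmulAeq ww; have wsm := rngmulAeq ws.
have swm := rngmulAeq sw; have wtm := rngmulAeq wt.
have twm := rngmulAeq tw; have tsm := rngmulAeq ts.
apply: (infinite_idempotent_criterion (s := x ** b ** s ** a)
  (t := x ** b ** t ** a)); rewrite -!rngmulA;
  rewrite ?(axbm, wwm, wsm, swm, wtm, twm, tsm) //.
(* Sandwiching between [a] and [x ** b] undoes the transport and gives [s ** t = w]. *)
move=> /(congr1 (fun y => a ** y ** (x ** b))); rewrite -!rngmulA.
by rewrite ?(axbm, axb', wsm, wwm, wtm, ww, ws, tw).
Qed.

End RngTheory.

(** * Presented algebras: induction and universal property *)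

Section PresentedTheory.
Variables (K : fieldType) (X : Type).
Variable rel : ralg_term K X -> ralg_term K X -> Prop.
Local Notation cls := (prs_class rel).

Lemma prs_classD x y : cls (tadd x y) = cls x + cls y.
Proof. by rewrite -prs_addE. Qed.

Lemma prs_classZ a x : cls (tscale a x) = a *: cls x.
Proof. by rewrite -prs_scaleE. Qed.

Lemma prs_classM x y : cls (tmul x y) = cls x ** cls y.
Proof. by rewrite -prs_mulE. Qed.

Lemma prs_class_sum (I : Type) (r : seq I) (F : I -> ralg_term K X) :
  cls (\big[@tadd K X/tzero]_(i <- r) F i) = \sum_(i <- r) cls (F i).
Proof.
elim: r => [|i r IH]; first by rewrite !big_nil.
by rewrite !big_cons prs_classD IH.
Qed.

Lemma presented_ind (P : presented rel -> Prop) :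
  (forall x, P (cls (tgen x))) -> P 0 ->
  (forall x y, P x -> P y -> P (x + y)) ->
  (forall a x, P x -> P (a *: x)) ->
  (forall x y, P x -> P y -> P (x ** y)) -> forall x, P x.
Proof.
move=> Pg P0 PD PZ PM; elim/prs_ind; elim=> [g||x Px y Py|a x Px|x Px y Py].
- exact: Pg.
- exact: P0.
- by rewrite prs_classD; exact: PD.
- by rewrite prs_classZ; exact: PZ.
- by rewrite prs_classM; exact: PM.
Qed.

Variable B : ralgType K.

Fixpoint term_eval (g : X -> B) (t : ralg_term K X) : B :=
  match t with
  | tgen x => g x
  | tzero => 0
  | tadd x y => term_eval g x + term_eval g y
  | tscale a x => a *: term_eval g x
  | tmul x y => term_eval g x ** term_eval g y
  end.

Lemma term_eval_sum (g : X -> B) (I : Type) (r : seq I) (F : I -> ralg_term K X) :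
  term_eval g (\big[@tadd K X/tzero]_(i <- r) F i) =
  \sum_(i <- r) term_eval g (F i).
Proof.
elim: r => [|i r IH]; first by rewrite !big_nil.
by rewrite !big_cons /= IH.
Qed.

(** Universal property: evaluation of terms respects each clause of the congruence, hence factors
    through the quotient. *)
Lemma presented_lift (g : X -> B) :
  (forall x y, rel x y -> term_eval g x = term_eval g y) ->
  exists f : {linear presented rel -> B},
    {morph f : x y / x ** y} /\ forall x, f (cls (tgen x)) = g x.
Proof.
move=> grel.
have gcong x y : ralg_cong rel x y -> term_eval g x = term_eval g y.
  elim=> {x y} /=; first (by exact: grel);
    try by [| move=> *; congruence].
  - by move=> *; rewrite addrA.
  - by move=> *; rewrite addrC.
  - by move=> *; rewrite add0r.
  - by move=> x; rewrite scaleN1r addNr.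
  - by move=> *; rewrite scalerA.
  - by move=> *; rewrite scale1r.
  - by move=> *; rewrite scalerDr.
  - by move=> *; rewrite scalerDl.
  - by move=> *; rewrite rngmulA.
  - by move=> *; rewrite rngmulDl.
  - by move=> *; rewrite rngmulDr.
  - by move=> *; rewrite rngscaleAl.
  - by move=> *; rewrite rngscaleAr.
pose f (u : presented rel) := term_eval g (prs_repr u).
have fE x : f (cls x) = term_eval g x by apply/gcong/prs_reprP.
have flin : linear f.
  move=> a; elim/prs_ind=> x; elim/prs_ind=> y.
  by rewrite -prs_classZ -prs_classD !fE.
have fM : {morph f : x y / x ** y}.
  by elim/prs_ind=> x; elim/prs_ind=> y; rewrite -prs_classM !fE.
pose m := GRing.isLinear.Build K (presented rel) B *:%R f flin.
by exists (HB.pack f m : {linear _ -> _}); split=> // x; exact: fE.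
Qed.

End PresentedTheory.

(** * Concatenation of paths *)

Section PathTheory.
Variable E : graph.
Implicit Types (u v w : vertex E) (e : edge E) (p q : seq (edge E)).

Lemma is_path_cat u p q w :
  is_path u (p ++ q) w <-> exists2 v, is_path u p v & is_path v q w.
Proof.
elim: p u => [|e p IH] u /=.
  by split=> [?|[v -> //]]; exists u.
split=> [[<- /IH[v pv vq]]|[v [<- pv] vq]]; first by exists v.
by split=> //; apply/IH; exists v.
Qed.

Lemma is_path_inj u p w w' : is_path u p w -> is_path u p w' -> w = w'.
Proof.
elim: p u => [|e p IH] u /=; first by move=> <-.
by move=> [_ pw] [_ pw']; exact: IH pw pw'.
Qed.

End PathTheory.

(** * Multiplication rules for generators, paths and ghost paths *)

Section LeavittTheory.
Variables (K : fieldType) (E : graph).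
Implicit Types (u v w : vertex E) (e : edge E) (p q : seq (edge E)).
Implicit Types (x y z : LPA K E).

Local Notation V := (lpa_vtx K).

Definition lpa_edge e : LPA K E := prs_class (@lpa_rel K E) (tgen (gedge e)).
Definition lpa_ghost e : LPA K E := prs_class (@lpa_rel K E) (tgen (gghost e)).

Lemma lpa_ind (P : LPA K E -> Prop) :
  (forall v, P (V v)) -> (forall e, P (lpa_edge e)) ->
  (forall e, P (lpa_ghost e)) -> P 0 ->
  (forall x y, P x -> P y -> P (x + y)) ->
  (forall a x, P x -> P (a *: x)) ->
  (forall x y, P x -> P y -> P (x ** y)) -> forall x, P x.
Proof. by move=> PV PD PG; apply: presented_ind; case. Qed.

Lemma lpa_vtxM v w : V v ** V w = if v == w then V v else 0 :> LPA K E.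
Proof.
by rewrite -prs_classM (proj2 (prs_classP _ _ _) (cong_rel (lpa_vertex K v w)));
  case: ifP.
Qed.

Lemma lpa_vtx_id v : V v ** V v = V v :> LPA K E.
Proof. by rewrite lpa_vtxM eqxx. Qed.

Lemma lpa_vtx_edge v e : V v ** lpa_edge e = if v == src e then lpa_edge e else 0.
Proof.
have eE : V (src e) ** lpa_edge e = lpa_edge e.
  by rewrite -prs_classM; apply/prs_classP/cong_rel/lpa_src_edge.
case: eqP => [->//|ve]; rewrite -eE rngmulA lpa_vtxM.
by case: eqP => // _; rewrite rngmul0r.
Qed.

Lemma lpa_edge_vtx v e : lpa_edge e ** V v = if v == tgt e then lpa_edge e else 0.
Proof.
have eE : lpa_edge e ** V (tgt e) = lpa_edge e.
  by rewrite -prs_classM; apply/prs_classP/cong_rel/lpa_edge_tgt.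
case: eqP => [->//|ve]; rewrite -eE -rngmulA lpa_vtxM.
by case: eqP => [ve'|_]; [case: ve|rewrite rngmulr0].
Qed.

Lemma lpa_vtx_ghost v e :
  V v ** lpa_ghost e = if v == tgt e then lpa_ghost e else 0.
Proof.
have eE : V (tgt e) ** lpa_ghost e = lpa_ghost e.
  by rewrite -prs_classM; apply/prs_classP/cong_rel/lpa_tgt_ghost.
case: eqP => [->//|ve]; rewrite -eE rngmulA lpa_vtxM.
by case: eqP => // _; rewrite rngmul0r.
Qed.

Lemma lpa_ghost_vtx v e :
  lpa_ghost e ** V v = if v == src e then lpa_ghost e else 0.
Proof.
have eE : lpa_ghost e ** V (src e) = lpa_ghost e.
  by rewrite -prs_classM; apply/prs_classP/cong_rel/lpa_ghost_src.
case: eqP => [->//|ve]; rewrite -eE -rngmulA lpa_vtxM.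
by case: eqP => [ve'|_]; [case: ve|rewrite rngmulr0].
Qed.

Lemma lpa_ghost_edge e e' :
  lpa_ghost e ** lpa_edge e' = if e == e' then V (tgt e) else 0.
Proof.
rewrite -prs_classM (proj2 (prs_classP _ _ _) (cong_rel (lpa_CK1 K e e'))).
by case: ifP.
Qed.

Lemma lpa_vtx_sum v : regular v ->
  V v = \sum_(e <- fset_set (out_edges v)) lpa_edge e ** lpa_ghost e.
Proof.
move=> rv; rewrite [LHS](proj2 (prs_classP _ _ _) (cong_rel (lpa_CK2 K rv))).
by rewrite prs_class_sum; under eq_bigr do rewrite prs_classM.
Qed.

(** The end vertex is an argument because the empty sequence does not determine it; the trivial path
    at [w] is the idempotent [w]. *)
Fixpoint lpa_path p w : LPA K E :=
  if p is e :: p' then lpa_edge e ** lpa_path p' w else V w.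

Fixpoint lpa_gpath p w : LPA K E :=
  if p is e :: p' then lpa_gpath p' w ** lpa_ghost e else V w.

Local Notation P := lpa_path.
Local Notation Q := lpa_gpath.

Lemma lpa_path_vtx p w : P p w ** V w = P p w.
Proof.
by elim: p => [|e p IH] /=; rewrite ?lpa_vtx_id // -rngmulA IH.
Qed.

Lemma lpa_vtx_gpath p w : V w ** Q p w = Q p w.
Proof.
by elim: p => [|e p IH] /=; rewrite ?lpa_vtx_id // rngmulA IH.
Qed.

Lemma lpa_vtx_path v u p w : is_path u p w ->
  V v ** P p w = if v == u then P p w else 0.
Proof.
case: p => [<-|e p [<- _]] /=; first by rewrite lpa_vtxM; case: eqP => // ->.
by rewrite rngmulA lpa_vtx_edge; case: eqP => // _; rewrite rngmul0r.
Qed.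

Lemma lpa_gpath_vtx v u p w : is_path u p w ->
  Q p w ** V v = if v == u then Q p w else 0.
Proof.
case: p => [<-|e p [<- _]] /=.
  by rewrite lpa_vtxM eq_sym; case: eqP => // ->.
by rewrite -rngmulA lpa_ghost_vtx; case: eqP => // _; rewrite rngmulr0.
Qed.

Lemma lpa_path_cat p q v w : is_path v q w -> P (p ++ q) w = P p v ** P q w.
Proof.
move=> vq; elim: p => [|e p IH] /=; last by rewrite IH rngmulA.
by rewrite (lpa_vtx_path _ vq) eqxx.
Qed.

Lemma lpa_gpath_cat p q v w : is_path v q w -> Q (p ++ q) w = Q q w ** Q p v.
Proof.
move=> vq; elim: p => [|e p IH] /=; last by rewrite IH rngmulA.
by rewrite (lpa_gpath_vtx _ vq) eqxx.
Qed.

Lemma lpa_gpath_path u p w q w' :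
  is_path u p w -> is_path u q w' -> (size p <= size q)%N ->
  (exists q', [/\ q = p ++ q', is_path w q' w' & Q p w ** P q w' = P q' w']) \/
  Q p w ** P q w' = 0 /\ p <> q.
Proof.
elim: p u q => [|e p IH] u q /=.
  move=> -> wq _; left; exists q; split=> //.
  by rewrite (lpa_vtx_path _ wq) eqxx.
case: q => [//|e' q] [<- ep] /= [_ e'q] pq.
rewrite -rngmulA (rngmulA (lpa_ghost e)) lpa_ghost_edge.
case: (eqVneq e e') ep => [->|ee'] ep; last first.
  by right; rewrite rngmul0r rngmulr0; split=> // -[] /eqP; rewrite (negPf ee').
rewrite (lpa_vtx_path _ e'q) eqxx.
case: (IH _ _ ep e'q pq) => [[q' [-> wq' ->]]|[-> pnq]].
  by left; exists q'.
by right; split=> // -[].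
Qed.

Lemma lpa_gpath_pathK u p w : is_path u p w -> Q p w ** P p w = V w.
Proof.
move=> up; case: (lpa_gpath_path up up (leqnn _)) => [[q' [pE _ ->]]|[_ //]].
suff -> : q' = [::] by [].
by apply/nilP; rewrite /nilp -(eqn_add2l (size p)) -size_cat -pE addn0.
Qed.

End LeavittTheory.

Arguments lpa_edge K {E} e.
Arguments lpa_ghost K {E} e.
Arguments lpa_path K {E} p w.
Arguments lpa_gpath K {E} p w.

(** * Vertices are nonzero: the representation on boundary paths *)

Section BoundaryPathRepresentation.
Variables (K : fieldType) (E : graph).
Implicit Types (v w : vertex E) (e : edge E).

(* A boundary path, infinite or ending at a vertex that is not regular, is
   encoded as a sequence of vertices with the edge taken next; an ended path
   repeats its last vertex with [None]. *)
Definition is_boundary_path (z : nat -> vertex E * option (edge E)) :=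
  forall n, match (z n).2 with
  | Some e => src e = (z n).1 /\ (z n.+1).1 = tgt e
  | None => ~ regular (z n).1 /\ z n.+1 = z n
  end.

Definition boundary_path := {z | is_boundary_path z}.
Implicit Types (z : boundary_path) (g : boundary_path -> K).

Definition bpath_source z := (sval z 0).1.
Definition bpath_head z := (sval z 0).2.

Lemma bpath_tail_subproof z : is_boundary_path (fun n => sval z n.+1).
Proof. by move=> n; exact: (svalP z n.+1). Qed.

Definition bpath_tail z : boundary_path := exist _ _ (bpath_tail_subproof z).

Lemma bpath_cons_subproof e z (H : bpath_source z = tgt e) :
  is_boundary_path (fun n => if n is m.+1 then sval z m else (src e, Some e)).
Proof. by case=> [|n] //=; exact: (svalP z n). Qed.

Definition bpath_cons e z H : boundary_path :=
  exist _ _ (@bpath_cons_subproof e z H).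

Lemma bpath_consK e z H : bpath_tail (@bpath_cons e z H) = z.
Proof. by case: z H => z zP H; apply: eq_exist. Qed.

Lemma bpath_head_source z e :
  bpath_head z = Some e -> bpath_source z = src e.
Proof.
by rewrite /bpath_head /bpath_source; have := svalP z 0; case: (sval z 0).2 =>
  // e' [<- _] [->].
Qed.

Lemma bpath_head_tail z e :
  bpath_head z = Some e -> bpath_source (bpath_tail z) = tgt e.
Proof.
by rewrite /bpath_head /bpath_source; have := svalP z 0; case: (sval z 0).2 =>
  // e' [_ ->] [->].
Qed.

Lemma bpath_headK z e H :
  bpath_head z = Some e -> @bpath_cons e (bpath_tail z) H = z.
Proof.
move=> ze; have zs := bpath_head_source ze.
case: z zs ze H => z zP; rewrite /bpath_head /bpath_source /= => zs ze H.
apply: eq_exist; apply/funext=> -[|n] //=.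
by case: (z 0) zs ze => a b /= -> ->.
Qed.

Lemma bpath_head_regular z :
  regular (bpath_source z) -> exists e, bpath_head z = Some e.
Proof.
rewrite /bpath_head /bpath_source; have := svalP z 0.
by case: (sval z 0).2 => [e _ _|[]//]; exists e.
Qed.

(** Choose one outgoing edge at every regular vertex and follow the choices from [v], stopping at
    the first vertex that is not regular. *)
Lemma bpath_exists v : exists z, bpath_source z = v.
Proof.
have /choice[next nextP] (u : vertex E) : exists o : option (edge E),
    if o is Some e then src e = u else ~ regular u.
  by have [[_ [e eu]]|] := pselect (regular u); [exists (Some e)|exists None].
pose step u := if next u is Some e then tgt e else u.
have zP : is_boundary_path (fun n => (iter n step v, next (iter n step v))).
  move=> n /=; have stepE u : step u = if next u is Some e then tgt e else u by [].
  have := nextP (iter n step v); rewrite stepE.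
  by case nE: (next (iter n step v)) => [e|] //; rewrite nE.
by exists (exist _ _ zP).
Qed.

(** An edge evaluates the function at the tail of a path that starts with this edge; a ghost edge
    evaluates it at the path prolonged by the edge in front. Since the action is defined on terms,
    the relations can be checked one by one. *)
Fixpoint bpath_act (t : ralg_term K (lpa_gen E)) g : boundary_path -> K :=
  match t with
  | tgen (gvertex v) => fun z => if bpath_source z == v then g z else 0
  | tgen (gedge e) =>
      fun z => if bpath_head z == Some e then g (bpath_tail z) else 0
  | tgen (gghost e) => fun z =>
      if pselect (bpath_source z = tgt e) is left H then g (bpath_cons H) else 0
  | tzero => fun=> 0
  | tadd x y => fun z => bpath_act x g z + bpath_act y g z
  | tscale a x => fun z => a * bpath_act x g z
  | tmul x y => bpath_act x (bpath_act y g)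
  end.

Lemma bpath_actD t g h :
  bpath_act t (fun z => g z + h z) = fun z => bpath_act t g z + bpath_act t h z.
Proof.
elim: t g h => [[v|e|e]||x IHx y IHy|a x IHx|x IHx y IHy] g h;
  apply/funext=> z //=.
- by case: ifP; rewrite ?addr0.
- by case: ifP; rewrite ?addr0.
- by case: pselect; rewrite ?addr0.
- by rewrite addr0.
- by rewrite IHx IHy addrACA.
- by rewrite IHx mulrDr.
- by rewrite IHy IHx.
Qed.

Lemma bpath_actZ t a g :
  bpath_act t (fun z => a * g z) = fun z => a * bpath_act t g z.
Proof.
elim: t g => [[v|e|e]||x IHx y IHy|b x IHx|x IHx y IHy] g;
  apply/funext=> z //=.
- by case: ifP; rewrite ?mulr0.
- by case: ifP; rewrite ?mulr0.
- by case: pselect; rewrite ?mulr0.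
- by rewrite mulr0.
- by rewrite IHx IHy mulrDr.
- by rewrite IHx mulrCA.
- by rewrite IHy IHx.
Qed.

Lemma bpath_act_sum (I : Type) (r : seq I) (F : I -> ralg_term K (lpa_gen E)) g z :
  bpath_act (\big[@tadd K _/tzero]_(i <- r) F i) g z =
  \sum_(i <- r) bpath_act (F i) g z.
Proof.
elim: r => [|i r IH]; first by rewrite !big_nil.
by rewrite !big_cons /= IH.
Qed.

Lemma bpath_act_edge_ghost e g z :
  bpath_act (tmul (tgen (gedge e)) (tgen (gghost e))) g z =
  if bpath_head z == Some e then g z else 0.
Proof.
rewrite /=; case: eqP => // ze; case: pselect => [H|].
  by rewrite bpath_headK.
by case; exact: bpath_head_tail.
Qed.

(** The relation at a regular vertex holds because a boundary path starting there has exactly one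
    first edge, so exactly one summand survives. *)
Lemma bpath_act_rel x y : lpa_rel x y -> bpath_act x = bpath_act y.
Proof.
move=> xy; apply/funext=> g; apply/funext=> z.
case: xy => {x y} [v w|e|e|e|e|e e'|v rv] /=.
- by case: (eqVneq v w) => [->|vw] /=; case: eqP => // ->; rewrite (negPf vw).
- by case: (bpath_head z =P _) => [/bpath_head_source ->|_]; rewrite ?eqxx ?if_same.
- by case: eqP => // /bpath_head_tail ->; rewrite eqxx.
- by case: eqP; case: pselect.
- by case: pselect => // H; rewrite eqxx.
- case: pselect => [H|nH] /=.
    rewrite bpath_consK {1}/bpath_head /=; case: (eqVneq e e') => [ee'|ee'] /=.
      by rewrite -ee' H !eqxx.
    by case: eqP => // -[] /eqP; rewrite (negPf ee').
  by case: ifP => //= _; case: eqP.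
- rewrite bpath_act_sum; under eq_bigr do rewrite bpath_act_edge_ghost.
  case: eqP => [zv|zv]; last first.
    rewrite big_seq big1 // => e; rewrite in_fset_set ?inE; last exact: (proj1 rv).
    by move=> ev; case: eqP => // /bpath_head_source ze; case: zv; rewrite ze.
  have [e ze] : exists e, bpath_head z = Some e.
    by apply: bpath_head_regular; rewrite zv.
  rewrite (bigD1_seq e) ?fset_uniq //=; last first.
    rewrite in_fset_set ?inE /=; last exact: (proj1 rv).
    by rewrite -zv; apply/esym/bpath_head_source.
  rewrite ze eqxx big1 ?addr0 // => e' e'e.
  by case: eqP => // -[] /esym/eqP; rewrite (negPf e'e).
Qed.

Lemma bpath_act_cong x y : ralg_cong (@lpa_rel K E) x y -> bpath_act x = bpath_act y.
Proof.
elim=> {x y} /=; first (by exact: bpath_act_rel); try by [| move=> *; congruence].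
- by move=> x x' y y' _ xx _ yy; apply/funext=> g; apply/funext=> z; rewrite xx yy.
- by move=> a x x' _ xx; apply/funext=> g; apply/funext=> z; rewrite xx.
- by move=> x x' y y' _ xx _ yy; apply/funext=> g; rewrite xx yy.
- by move=> *; apply/funext=> g; apply/funext=> z; rewrite addrA.
- by move=> *; apply/funext=> g; apply/funext=> z; rewrite addrC.
- by move=> *; apply/funext=> g; apply/funext=> z; rewrite add0r.
- by move=> *; apply/funext=> g; apply/funext=> z; rewrite mulN1r addNr.
- by move=> *; apply/funext=> g; apply/funext=> z; rewrite mulrA.
- by move=> *; apply/funext=> g; apply/funext=> z; rewrite mul1r.
- by move=> *; apply/funext=> g; apply/funext=> z; rewrite mulrDr.
- by move=> *; apply/funext=> g; apply/funext=> z; rewrite mulrDl.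
- by move=> *; apply/funext=> g; rewrite bpath_actD.
- by move=> *; apply/funext=> g; rewrite bpath_actZ.
Qed.

Lemma lpa_vtx_neq0 v : lpa_vtx K v <> 0.
Proof.
move=> /prs_classP /bpath_act_cong vE; have [z zv] := bpath_exists v.
have /eqP := congr1 (fun f => f (fun=> 1) z) vE.
by rewrite /= zv eqxx oner_eq0.
Qed.

End BoundaryPathRepresentation.

(** * Local units and spanning monomials *)

Section LeavittSpan.
Variables (K : fieldType) (E : graph).
Implicit Types (u v w : vertex E) (e : edge E) (p q : seq (edge E)).
Implicit Types (x y z : LPA K E) (s : seq (vertex E)).

Local Notation V := (lpa_vtx K).
Local Notation P := (lpa_path K).
Local Notation Q := (lpa_gpath K).

Definition lpa_unit s : LPA K E := \sum_(v <- s) V v.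

Lemma lpa_unit_vtx s v : uniq s -> v \in s -> lpa_unit s ** V v = V v.
Proof.
move=> us vs; rewrite rngmul_suml (bigD1_seq v) //= lpa_vtx_id big1 ?addr0 //.
by move=> w wv; rewrite lpa_vtxM (negPf wv).
Qed.

Lemma lpa_vtx_unit s v : uniq s -> v \in s -> V v ** lpa_unit s = V v.
Proof.
move=> us vs; rewrite rngmul_sumr (bigD1_seq v) //= lpa_vtx_id big1 ?addr0 //.
by move=> w wv; rewrite lpa_vtxM eq_sym (negPf wv).
Qed.

Lemma lpa_unit_id s : uniq s -> lpa_unit s ** lpa_unit s = lpa_unit s.
Proof.
move=> us; rewrite {2}/lpa_unit rngmul_sumr.
by apply: eq_big_seq => v vs; exact: lpa_unit_vtx.
Qed.

(** The claim covers all larger lists [s'], so that in the induction the lists found for two factors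
    or summands can be merged. *)
Lemma lpa_unit_exists x : exists s, forall s', uniq s' -> {subset s <= s'} ->
  lpa_unit s' ** x = x /\ x ** lpa_unit s' = x.
Proof.
elim/lpa_ind: x => [v|e|e||x y [sx Hx] [sy Hy]|a x [sx Hx]|x y [sx Hx] [sy Hy]].
- exists [:: v] => s us vs; have vins : v \in s by apply: vs; rewrite inE.
  by rewrite lpa_unit_vtx // lpa_vtx_unit.
- exists [:: src e; tgt e] => s us vs.
  have ss : src e \in s by apply: vs; rewrite !inE eqxx.
  have ts : tgt e \in s by apply: vs; rewrite !inE eqxx orbT.
  have eE := lpa_vtx_edge K (src e) e; rewrite eqxx in eE.
  have Ee := lpa_edge_vtx K (tgt e) e; rewrite eqxx in Ee.
  split; first by rewrite -[X in _ ** X]eE rngmulA lpa_unit_vtx.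
  by rewrite -[X in X ** _]Ee -rngmulA lpa_vtx_unit.
- exists [:: src e; tgt e] => s us vs.
  have ss : src e \in s by apply: vs; rewrite !inE eqxx.
  have ts : tgt e \in s by apply: vs; rewrite !inE eqxx orbT.
  have eE := lpa_vtx_ghost K (tgt e) e; rewrite eqxx in eE.
  have Ee := lpa_ghost_vtx K (src e) e; rewrite eqxx in Ee.
  split; first by rewrite -[X in _ ** X]eE rngmulA lpa_unit_vtx.
  by rewrite -[X in X ** _]Ee -rngmulA lpa_vtx_unit.
- by exists [::] => s _ _; rewrite rngmul0r rngmulr0.
- exists (sx ++ sy) => s us sub.
  have [|xl xr] := Hx s us; first by move=> v vs; apply: sub; rewrite mem_cat vs.
  have [|yl yr] := Hy s us; first by move=> v vs; apply: sub; rewrite mem_cat vs orbT.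
  by rewrite rngmulDl rngmulDr xl xr yl yr.
- exists sx => s us sub; have [xl xr] := Hx s us sub.
  by rewrite -rngscaleAl -rngscaleAr xl xr.
- exists (sx ++ sy) => s us sub.
  have [|xl xr] := Hx s us; first by move=> v vs; apply: sub; rewrite mem_cat vs.
  have [|yl yr] := Hy s us; first by move=> v vs; apply: sub; rewrite mem_cat vs orbT.
  by rewrite rngmulA xl -rngmulA yr.
Qed.

Lemma lpa_unit_seq (l : seq (LPA K E)) : exists2 s, uniq s &
  forall x, x \in l -> lpa_unit s ** x = x /\ x ** lpa_unit s = x.
Proof.
suff [s sP] : exists s, forall s', uniq s' -> {subset s <= s'} ->
    forall x, x \in l -> lpa_unit s' ** x = x /\ x ** lpa_unit s' = x.
  exists (undup s); first exact: undup_uniq.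
  by apply: sP (undup_uniq s) _ => v; rewrite mem_undup.
elim: l => [|x l [s sP]]; first by exists [::].
have [sx sxP] := lpa_unit_exists x; exists (sx ++ s) => s' us' sub y.
rewrite inE => /predU1P[->|yl].
  by apply: sxP => // v vs; apply: sub; rewrite mem_cat vs.
by apply: sP => // v vs; apply: sub; rewrite mem_cat vs orbT.
Qed.

Lemma lpa_unitP x :
  exists2 s, uniq s & lpa_unit s ** x = x /\ x ** lpa_unit s = x.
Proof.
by have [s us sP] := lpa_unit_seq [:: x]; exists s => //; apply: sP; rewrite inE.
Qed.

Lemma lpa_has_local_units : has_local_units (LPA K E).
Proof.
move=> S /finite_seqP[l ->]; have [s us sP] := lpa_unit_seq l.
by exists (lpa_unit s); split; [exact: lpa_unit_id|exact: sP].
Qed.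

(** Combinations of monomials, a path starting in [A] followed by a ghost path ending at [v]. The
    bound [n] on the number of ghost edges is the measure for the reduction below. *)
Inductive lpa_span (A : set (vertex E)) v n : LPA K E -> Prop :=
| lpa_span0 : lpa_span A v n 0
| lpa_spanS k u p q w x : A u -> is_path u p w -> is_path v q w ->
    (size q <= n)%N -> lpa_span A v n x ->
    lpa_span A v n (k *: (P p w ** Q q w) + x).

Arguments lpa_spanS {A v n k u p q w x} Au up vq qn xS.

Lemma lpa_span_mono A v n u p q w : A u -> is_path u p w -> is_path v q w ->
  (size q <= n)%N -> lpa_span A v n (P p w ** Q q w).
Proof.
move=> Au up vq qn; rewrite -[_ ** _]addr0 -[_ ** _]scale1r.
by apply: lpa_spanS Au up vq qn _; exact: lpa_span0.
Qed.

Arguments lpa_span_mono {A v n u p q w} Au up vq qn.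

Lemma lpa_spanW A v n m x : (n <= m)%N -> lpa_span A v n x -> lpa_span A v m x.
Proof.
move=> nm; elim=> [|k u p q w {}x Au up vq qn _ IH]; first exact: lpa_span0.
by apply: lpa_spanS Au up vq _ IH; exact: leq_trans nm.
Qed.

Lemma lpa_spanD A v n x y :
  lpa_span A v n x -> lpa_span A v n y -> lpa_span A v n (x + y).
Proof.
move=> xS yS; elim: xS => [|k u p q w {}x Au up vq qn _ IH]; rewrite ?add0r //.
by rewrite -addrA; exact: lpa_spanS Au up vq qn IH.
Qed.

Lemma lpa_spanZ A v n a x : lpa_span A v n x -> lpa_span A v n (a *: x).
Proof.
elim=> [|k u p q w {}x Au up vq qn _ IH]; first by rewrite scaler0; exact: lpa_span0.
by rewrite scalerDr scalerA; exact: lpa_spanS Au up vq qn IH.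
Qed.

Lemma lpa_span_vtx A v : A v -> lpa_span A v 0 (V v).
Proof.
move=> Av; rewrite -[V v]lpa_vtx_id.
by apply: (@lpa_span_mono A v 0 v [::] [::] v).
Qed.

Lemma lpa_span_lin A B v v' n m (f : LPA K E -> LPA K E) :
  f 0 = 0 -> (forall x y, f (x + y) = f x + f y) ->
  (forall a x, f (a *: x) = a *: f x) ->
  (forall u p q w, A u -> is_path u p w -> is_path v q w -> (size q <= n)%N ->
     lpa_span B v' m (f (P p w ** Q q w))) ->
  forall x, lpa_span A v n x -> lpa_span B v' m (f x).
Proof.
move=> f0 fD fZ fm x.
elim=> [|k u p q w {}x Au up vq qn _ IH]; first by rewrite f0; exact: lpa_span0.
by rewrite fD fZ; apply: lpa_spanD IH; apply: lpa_spanZ; exact: fm up vq qn.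
Qed.

(** The bound grows only when a ghost edge meets a monomial without real edges; a ghost edge
    otherwise cancels the first edge or gives zero. *)
Lemma lpa_span_mull x y v n :
  lpa_span setT v n y -> exists m, lpa_span setT v m (x ** y).
Proof.
elim/lpa_ind: x y n => [u|e|e||x x' IH IH'|a x IH|x x' IH IH'] y n yS.
- exists n; apply: lpa_span_lin yS; rewrite ?rngmulr0 //.
  + by move=> *; rewrite rngmulDr.
  + by move=> *; rewrite -rngscaleAr.
  move=> u' p q w _ up vq qn; rewrite rngmulA (lpa_vtx_path _ _ up).
  by case: ifP => _; [exact: lpa_span_mono I up vq qn|rewrite rngmul0r; exact: lpa_span0].
- exists n; apply: lpa_span_lin yS; rewrite ?rngmulr0 //.
  + by move=> *; rewrite rngmulDr.
  + by move=> *; rewrite -rngscaleAr.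
  move=> u' p q w _ up vq qn; have [u'e|u'e] := eqVneq u' (tgt e).
    rewrite rngmulA; apply: (@lpa_span_mono _ _ _ (src e) (e :: p) _ _ I _ vq qn) => /=.
    by rewrite -u'e.
  have <- : V u' ** P p w = P p w by rewrite (lpa_vtx_path _ _ up) eqxx.
  rewrite !rngmulA lpa_edge_vtx (negPf u'e) !rngmul0r; exact: lpa_span0.
- exists n.+1; apply: lpa_span_lin yS; rewrite ?rngmulr0 //.
  + by move=> *; rewrite rngmulDr.
  + by move=> *; rewrite -rngscaleAr.
  move=> u' [|e' p] q w _ /= up vq qn.
    rewrite rngmulA lpa_ghost_vtx; case: eqP => we; last first.
      by rewrite rngmul0r; exact: lpa_span0.
    have ep : is_path w [:: e] (tgt e) by [].
    rewrite (_ : lpa_ghost K e = Q [:: e] (tgt e)); last first.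
      by rewrite /= lpa_vtx_ghost eqxx.
    rewrite -[Q [:: e] _]lpa_vtx_gpath -rngmulA.
    have <- := lpa_gpath_cat K q ep.
    apply: (@lpa_span_mono _ _ _ (tgt e) [::]) => //.
      by apply/is_path_cat; exists w.
    by rewrite size_cat addn1.
  case: up => _ up; rewrite rngmulA rngmulA lpa_ghost_edge.
  case: eqP => [->|_]; last by rewrite !rngmul0r; exact: lpa_span0.
  by rewrite (lpa_vtx_path _ _ up) eqxx; apply: lpa_span_mono I up vq _; exact: leqW.
- by exists 0%N; rewrite rngmul0r; exact: lpa_span0.
- have [m xS] := IH _ _ yS; have [m' xS'] := IH' _ _ yS; exists (maxn m m').
  rewrite rngmulDl; apply: lpa_spanD.
    by apply: lpa_spanW xS; exact: leq_maxl.
  by apply: lpa_spanW xS'; exact: leq_maxr.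
- by have [m xS] := IH _ _ yS; exists m; rewrite -rngscaleAl; exact: lpa_spanZ.
- have [m xS'] := IH' _ _ yS; have [m' xS] := IH _ _ xS'.
  by exists m'; rewrite -rngmulA.
Qed.

(** The vertex [v] is a monomial, left multiplication by [x] stays in the span, and [V u] keeps only
    the paths that start at [u]. *)
Lemma lpa_span_corner x u v : exists n, lpa_span [set u] v n (V u ** x ** V v).
Proof.
have [n xS] := lpa_span_mull x (lpa_span_vtx (A := setT) (v := v) I).
exists n; rewrite -rngmulA; apply: lpa_span_lin xS; rewrite ?rngmulr0 //.
- by move=> *; rewrite rngmulDr.
- by move=> *; rewrite -rngscaleAr.
move=> u' p q w _ up vq qn; rewrite rngmulA (lpa_vtx_path _ _ up).
case: eqP => [->|_]; first exact: lpa_span_mono erefl up vq qn.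
by rewrite rngmul0r; exact: lpa_span0.
Qed.

Lemma lpa_corner_neq0 x : x <> 0 -> exists u v, V u ** x ** V v <> 0.
Proof.
move=> xn0; apply: contrapT => H; apply: xn0.
have [s us [sx xs]] := lpa_unitP x.
rewrite -sx -xs rngmul_suml big1 // => u _; rewrite !rngmul_sumr big1 // => v _.
by rewrite rngmulA; apply: contrapT => Hn; apply: H; exists u, v.
Qed.

End LeavittSpan.

Arguments lpa_unit K {E} s.

(** * Reduction of a nonzero element to the branching vertex *)

Section Reduction.
Variables (K : fieldType) (E : graph) (h : vertex E) (f g : edge E).
Hypotheses (src_f : src f = h) (src_g : src g = h) (neq_fg : f <> g).
Hypothesis to_h : forall v, exists p, is_path v p h.
Implicit Types (u v w : vertex E) (e : edge E) (p q r : seq (edge E)).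
Implicit Types (x y z : LPA K E).

Local Notation V := (lpa_vtx K).
Local Notation P := (lpa_path K).
Local Notation Q := (lpa_gpath K).
Local Notation D := (lpa_edge K).
Local Notation G := (lpa_ghost K).

(* Rotating the closed path [e :: q] along a path to the branching vertex [h]
   eventually makes them diverge. *)
Lemma closed_path_kill v e q p :
  is_path v p h -> is_path v (e :: q) v ->
  exists r w, is_path v r w /\ Q r w ** P (e :: q) v ** P r w = 0.
Proof.
elim: p v e q => [|e' p IH] v e q /=.
  move=> -> [eh _]; have [e' [e'h ee']] : exists e', src e' = h /\ e' != e.
    have [fe|fe] := eqVneq f e; last by exists f.
    by exists g; split=> //; apply/eqP=> ge; apply: neq_fg; rewrite fe ge.
  exists [:: e'], (tgt e'); split=> //=.
  by rewrite -!rngmulA (rngmulA (G e')) lpa_ghost_edge (negPf ee') !(rngmulr0, rngmul0r).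
move=> [e'v pP] [ev qP]; have [e'e|e'e] := eqVneq e' e; last first.
  exists [:: e'], (tgt e'); split=> //=.
  by rewrite -!rngmulA (rngmulA (G e')) lpa_ghost_edge (negPf e'e) !(rngmulr0, rngmul0r).
subst e'; have qe : is_path (tgt e) (q ++ [:: e]) (tgt e).
  by apply/is_path_cat; exists v.
have [r [w [rw r0]]] : exists r w, is_path (tgt e) r w /\
    Q r w ** P (q ++ [:: e]) (tgt e) ** P r w = 0.
  by case: q qP qe => [|e' q] qP qe; exact: IH pP qe.
exists (e :: r), w; split=> //=; rewrite -r0.
rewrite (lpa_path_cat K q (_ : is_path v [:: e] (tgt e))) //=.
rewrite lpa_edge_vtx eqxx -!rngmulA.
rewrite (rngmulA (G e)) lpa_ghost_edge eqxx (rngmulA (V (tgt e))).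
by rewrite (lpa_vtx_path _ _ qP) eqxx.
Qed.

(** Compare [r] with [q ++ r]: if [r] is a prefix, what is left is a rotated closed path. Its length
    equals that of [q], so a nontrivial closed path stays nontrivial. *)
Lemma closed_path_conj v q r w : is_path v q v -> is_path v r w ->
  (exists q', [/\ size q' = size q, is_path w q' w &
     Q r w ** P q v ** P r w = P q' w]) \/ Q r w ** P q v ** P r w = 0.
Proof.
move=> vq vr; have vqr : is_path v (q ++ r) w by apply/is_path_cat; exists v.
rewrite -rngmulA -(lpa_path_cat K q vr).
case: (lpa_gpath_path K vr vqr _); first by rewrite size_cat leq_addl.
  move=> [q' [qE wq' ->]]; left; exists q'; split=> //.
  by apply/eqP; rewrite -(eqn_add2r (size r)) -!size_cat qE !size_cat addnC.
by move=> [-> _]; right.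
Qed.

Inductive lpa_closed_span v : LPA K E -> Prop :=
| lpa_closed_span0 : lpa_closed_span v 0
| lpa_closed_spanS k e q z : is_path v (e :: q) v -> lpa_closed_span v z ->
    lpa_closed_span v (k *: P (e :: q) v + z).

(** The terms are killed one at a time: each step prolongs the conjugating path, and terms that are
    already zero stay zero. The prescribed beginning [r0] serves at vertices that emit infinitely
    many edges. *)
Lemma closed_span_kill v z r0 w0 :
  lpa_closed_span v z -> is_path v r0 w0 ->
  exists r w, is_path v (r0 ++ r) w /\ Q (r0 ++ r) w ** z ** P (r0 ++ r) w = 0.
Proof.
move=> zS vr0; elim: zS => [|k e q {}z vq _ [r [w [vr rz]]]].
  by exists [::], w0; rewrite cats0 rngmulr0 rngmul0r.
case: (closed_path_conj vq vr) => [[q' [qq' wq' q'E]]|q0]; last first.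
  exists r, w; split=> //.
  by rewrite rngmulDr rngmulDl rz -rngscaleAr -rngscaleAl q0 scaler0 addr0.
case: q' qq' wq' q'E => [//|e' q'] _ wq' q'E.
have [p wp] := to_h w; have [r' [w' [wr' r'0]]] := closed_path_kill wp wq'.
exists (r ++ r'), w'; rewrite catA; split; first by apply/is_path_cat; exists w.
rewrite (lpa_path_cat K _ wr') (lpa_gpath_cat K _ wr').
rewrite rngmulDr rngmulDl -rngscaleAr -rngscaleAl.
have assoc x : Q r' w' ** Q (r0 ++ r) w ** x ** (P (r0 ++ r) w ** P r' w') =
    Q r' w' ** (Q (r0 ++ r) w ** x ** P (r0 ++ r) w) ** P r' w'.
  by rewrite !rngmulA.
by rewrite !assoc rz q'E r'0 scaler0 rngmulr0 rngmul0r addr0.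
Qed.

(** With no ghost edges allowed only real paths remain; the coefficients of equal paths are
    collected. *)
Lemma lpa_span0_sum u v y : lpa_span [set u] v 0 y -> exists (s : seq (seq (edge E))) c,
  [/\ uniq s, forall p, p \in s -> is_path u p v & y = \sum_(p <- s) c p *: P p v].
Proof.
elim=> [|k _ p q w {}y -> up vq q0 _ [s [c [us sP ->]]]].
  by exists [::], (fun=> 0); rewrite big_nil.
case: q q0 vq => // _ /= vw; subst w; rewrite lpa_path_vtx.
have [ps|ps] := boolP (p \in s).
  exists s, (fun q => if q == p then k + c q else c q); split=> //.
  rewrite (bigD1_seq p) //= [in RHS](bigD1_seq p) //= eqxx scalerDl addrA.
  by congr (_ + _); apply: eq_bigr => q /negPf ->.
exists (p :: s), (fun q => if q == p then k else c q); split=> //=.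
- by rewrite ps.
- by move=> q; rewrite inE => /predU1P[->|/sP].
rewrite big_cons eqxx; congr (_ + _); apply: eq_big_seq => q qs.
by case: eqP => // qp; rewrite -qp qs in ps.
Qed.

(* Multiply by the ghost of a shortest path with nonzero coefficient. *)
Lemma lpa_span0_lead u v y : lpa_span [set u] v 0 y -> y <> 0 ->
  exists p k z, [/\ k != 0, lpa_closed_span v z & Q p v ** y = k *: V v + z].
Proof.
move=> /lpa_span0_sum[s [c [us sP yE]]] yn0.
have [p [ps cp pmin]] : exists p, [/\ p \in s, c p != 0 &
    forall q, q \in s -> c q != 0 -> (size p <= size q)%N].
  have [|n /hasP[p ps /andP[cp /eqP pn]] nmin] :=
      @ex_minnP (fun n => has (fun p => (c p != 0) && (size p == n)) s).
    have /hasP[p ps cp] : has (fun p => c p != 0) s.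
      apply: contrapT => /negP; rewrite -all_predC => /allP s0; apply: yn0.
      rewrite yE big_seq big1 // => p /s0 /=; rewrite negbK => /eqP ->.
      by rewrite scale0r.
    by exists (size p); apply/hasP; exists p; rewrite ?cp //=.
  exists p; split=> // q qs cq; rewrite pn; apply: nmin.
  by apply/hasP; exists q; rewrite ?cq //=.
exists p, (c p), (\sum_(q <- s | q != p) c q *: (Q p v ** P q v)); split=> //.
  rewrite big_seq_cond; apply: (big_ind (lpa_closed_span v)).
  - exact: lpa_closed_span0.
  - move=> x y' xS y'S; elim: xS => [|k e q z vq _ IH]; rewrite ?add0r //.
    by rewrite -addrA; exact: lpa_closed_spanS.
  move=> q /andP[qs qp]; have [->|cq] := eqVneq (c q) 0.
    by rewrite scale0r; exact: lpa_closed_span0.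
  have [[q' [qE vq' ->]]|[-> _]] :=
      lpa_gpath_path K (sP _ ps) (sP _ qs) (pmin _ qs cq); last first.
    by rewrite scaler0; exact: lpa_closed_span0.
  case: q' qE vq' => [qE|e q' _ vq']; first by rewrite qE cats0 eqxx in qp.
  by rewrite -[_ *: _]addr0; apply: lpa_closed_spanS => //; exact: lpa_closed_span0.
rewrite yE rngmul_sumr (bigD1_seq p) //= -rngscaleAr (lpa_gpath_pathK _ (sP _ ps)).
by congr (_ + _); apply: eq_bigr => q _; rewrite rngscaleAr.
Qed.

Definition reduces_to_h x := exists a b, a ** x ** b = V h.

Lemma reduces_to_h_mul a x b : reduces_to_h (a ** x ** b) -> reduces_to_h x.
Proof. by move=> [c [d E']]; exists (c ** a), (b ** d); rewrite -E' !rngmulA. Qed.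

Lemma reduces_to_h_vtx k w x a b :
  k != 0 -> a ** x ** b = k *: V w -> reduces_to_h x.
Proof.
move=> kn0 axb; apply: (@reduces_to_h_mul a x b); rewrite axb.
have [p wp] := to_h w; exists (k^-1 *: Q p h), (P p h).
rewrite -rngscaleAr -!rngscaleAl scalerA mulfV // scale1r.
by rewrite (lpa_gpath_vtx _ _ wp) eqxx (lpa_gpath_pathK _ wp).
Qed.

(** Here [x] may contain ghost edges. It need only agree with the ghost-free [y] after
    multiplication by [r0], because the conjugating path is made to begin with [r0]. *)
Lemma reduces_to_h_span0 u v x y r0 w0 : lpa_span [set u] v 0 y -> y <> 0 ->
  is_path v r0 w0 -> x ** P r0 w0 = y ** P r0 w0 -> reduces_to_h x.
Proof.
move=> yS yn0 vr0 xy; have [p [k [z [kn0 zS pE]]]] := lpa_span0_lead yS yn0.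
have [r [w [vr rz]]] := closed_span_kill zS vr0.
have [w0' vr0' w0r] := (proj1 (is_path_cat _ _ _ _)) vr.
have w0E := is_path_inj vr0 vr0'; subst w0'.
apply: (@reduces_to_h_vtx k w x (Q (r0 ++ r) w ** Q p v) (P (r0 ++ r) w)) => //.
rewrite (_ : _ ** P _ _ = Q (r0 ++ r) w ** (Q p v ** y) ** P (r0 ++ r) w).
  rewrite pE rngmulDr rngmulDl rz addr0 -rngscaleAr -rngscaleAl.
  by rewrite (lpa_gpath_vtx _ _ vr) eqxx (lpa_gpath_pathK _ vr).
by rewrite (lpa_path_cat K _ w0r) -!rngmulA (rngmulA x) xy -!rngmulA.
Qed.

(** In a monomial the edge [e] cancels the last ghost edge, or gives zero, or lengthens the real
    path if there is no ghost edge. *)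
Lemma lpa_span_edge A e n x : lpa_span A (src e) n.+1 x ->
  lpa_span A (tgt e) n (x ** D e).
Proof.
apply: (lpa_span_lin (f := fun y => y ** D e)); rewrite ?rngmul0r //.
- by move=> *; rewrite rngmulDl.
- by move=> *; rewrite rngscaleAl.
move=> u p [|e' q] w Au up /=.
  move=> ew _; rewrite lpa_path_vtx.
  have ep : is_path w [:: e] (tgt e) by [].
  rewrite (_ : D e = P [:: e] (tgt e)); last by rewrite /= lpa_edge_vtx eqxx.
  rewrite -(lpa_path_cat K p ep) -lpa_path_vtx.
  apply: (@lpa_span_mono _ _ _ _ _ u _ [::]) => //.
  by apply/is_path_cat; exists w.
move=> [_ e'q] qn; rewrite -!rngmulA lpa_ghost_edge.
case: eqP => [e'e|_]; last by rewrite !rngmulr0; exact: lpa_span0.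
rewrite (lpa_gpath_vtx _ _ e'q) eqxx.
by apply: lpa_span_mono up _ qn => //; rewrite -e'e.
Qed.

(** Separates the monomials without ghost edges, in [y], from the others, in [z]. The list [s]
    collects the last ghost edges that occur in [z]. *)
Lemma lpa_span_split A v n x : lpa_span A v n x -> exists y z (s : seq (edge E)),
  [/\ x = y + z, lpa_span A v 0 y, forall e, e \in s -> src e = v,
      forall s', uniq s' -> {subset s <= s'} ->
        z ** (\sum_(e <- s') D e ** G e) = z &
      forall e, e \notin s -> z ** D e = 0].
Proof.
elim=> [|k u p q w {}x Au up vq _ _ [y [z [s [-> yS sv zs zf]]]]].
  exists 0, 0, [::]; split=> //; rewrite ?addr0 //; first exact: lpa_span0.
    by move=> *; rewrite rngmul0r.
  by move=> *; rewrite rngmul0r.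
case: q vq => [|e q] vq.
  exists (k *: (P p w ** Q [::] w) + y), z, s; split=> //; first by rewrite addrA.
  by apply: lpa_spanS Au up vq _ yS.
exists y, (k *: (P p w ** Q (e :: q) w) + z), (e :: s); split=> //.
- by rewrite addrCA.
- by move=> e'; rewrite inE => /predU1P[->|/sv//]; case: vq.
- move=> s' us' ss'; have es' : e \in s' by apply: ss'; rewrite inE eqxx.
  rewrite rngmulDl zs //; last by move=> e' e's; apply: ss'; rewrite inE e's orbT.
  congr (_ + _); rewrite -rngscaleAl -rngmulA; congr (_ *: (_ ** _)).
  rewrite /= -rngmulA rngmul_sumr (bigD1_seq e) //= big1 => [|e' e'e].
    by rewrite rngmulA lpa_ghost_edge eqxx lpa_vtx_ghost eqxx addr0.
  by rewrite rngmulA lpa_ghost_edge eq_sym (negPf e'e) rngmul0r.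
- move=> e'; rewrite inE negb_or => /andP[e'e /zf ze']; rewrite rngmulDl ze' addr0.
  by rewrite -rngscaleAl /= -!rngmulA lpa_ghost_edge eq_sym (negPf e'e) !rngmulr0 scaler0.
Qed.

(** Induction on the number of ghost edges. If some edge at [v] does not annihilate [x] on the
    right, multiplying by it lowers the bound; otherwise [v] is a sink or emits infinitely many
    edges. *)
Lemma reduces_to_h_span u v n x :
  lpa_span [set u] v n x -> x <> 0 -> reduces_to_h x.
Proof.
elim: n u v x => [|n IH] u v x xS xn0.
  exact: (reduces_to_h_span0 xS xn0 (r0 := [::]) (w0 := v)).
have [[e [ev xe]]|/forallNP xe] := pselect (exists e, src e = v /\ x ** D e <> 0).
  have [|a [b abE]] := IH u (tgt e) (x ** D e) _ xe.
    by apply: lpa_span_edge; rewrite ev.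
  by exists a, (D e ** b); rewrite -abE !rngmulA.
have {}xe e : src e = v -> x ** D e = 0.
  by move=> ev; apply: contrapT => xen0; apply: (xe e).
have xv : x ** V v = x.
  elim: xS => [|k u' p q w y _ _ vq _ _ IHy]; first by rewrite rngmul0r.
  by rewrite rngmulDl IHy -rngscaleAl -rngmulA (lpa_gpath_vtx _ _ vq) eqxx.
(* At a regular vertex, [x] would be the sum of the products [x ** D e ** G e], all of them zero. *)
have nreg : ~ regular v.
  move=> rv; apply: xn0; rewrite -xv (lpa_vtx_sum K rv) rngmul_sumr big_seq big1 // => e.
  rewrite in_fset_set ?inE => [ev|]; last exact: (proj1 rv).
  by rewrite rngmulA xe // rngmul0r.
have [y [z [s [xE yS sv zs zf]]]] := lpa_span_split xS.
(* Otherwise [x = z], and the sum of [D e ** G e] over [s] would fix [x] although every [x ** D e]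
   vanishes. *)
have yn0 : y <> 0.
  move=> y0; apply: xn0; rewrite xE y0 add0r.
  rewrite -(zs (undup s)) ?undup_uniq // => [|e]; last by rewrite mem_undup.
  rewrite rngmul_sumr big_seq big1 // => e; rewrite mem_undup => /sv ev.
  by rewrite rngmulA -[z]add0r -y0 -xE xe // rngmul0r.
have [[e ev]|nv] := pselect (exists e, src e = v); last first.
  have z0 : z = 0.
    rewrite -(zs [::]) //; first by rewrite big_nil rngmulr0.
    by move=> e /sv ev; case: nv; exists e.
  rewrite xE z0 addr0.
  exact: (reduces_to_h_span0 yS yn0 (r0 := [::]) (w0 := v)).
(* Infinitely many edges leave [v], so one avoids [s]; it kills [z] and leaves
   [x ** D e' = y ** D e']. *)
have [e' [e'v e's]] : exists e', src e' = v /\ e' \notin s.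
  apply: contrapT => H; apply: nreg; split; last by exists e.
  apply: (sub_finite_set _ (finite_seq s)) => e' /= e'v.
  by apply: contrapT => /negP e's; apply: H; exists e'.
apply: (reduces_to_h_span0 yS yn0 (r0 := [:: e']) (w0 := tgt e')) => //=.
by rewrite xE rngmulDl !(rngmulA z) zf // rngmul0r addr0.
Qed.

Lemma lpa_reduction x : x <> 0 -> exists a b, a ** x ** b = V h.
Proof.
move=> /lpa_corner_neq0[u [v xn0]].
have [n xS] := lpa_span_corner x u v.
exact: reduces_to_h_mul (reduces_to_h_span xS xn0).
Qed.

End Reduction.

(** * Pure infiniteness criterion and orthogonality of vertex ideals *)

Section LeavittIdeals.
Variables (K : fieldType) (E : graph).
Implicit Types (u v w : vertex E) (e : edge E) (p q r : seq (edge E)).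
Implicit Types (x y z : LPA K E) (J : set (LPA K E)).

Local Notation V := (lpa_vtx K).
Local Notation P := (lpa_path K).
Local Notation Q := (lpa_gpath K).

Lemma lpa_ideal_full J : two_sided_ideal J -> (forall v, J (V v)) -> J = setT.
Proof.
move=> [[Jadd JR] JL] JV; apply/seteqP; split=> // x _.
have [s us [<- _]] := lpa_unitP x; apply: JR.
exact: additive_subgroup_sum.
Qed.

Lemma lpa_ideal_path J u p w :
  two_sided_ideal J -> is_path u p w -> J (V u) -> J (V w).
Proof.
move=> [[_ JR] JL] up Ju; rewrite -(lpa_gpath_pathK K up).
by have := lpa_gpath_vtx K u up; rewrite eqxx => <-; apply/JR/JL.
Qed.

(** By the reduction a nonzero ideal contains [h], hence every vertex. The closed path through [f]
    and its ghost make [h] an infinite idempotent. *)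
Lemma lpa_purely_infinite_simple (h : vertex E) (f g : edge E) p :
  src g = h -> f <> g -> is_path h (f :: p) h ->
  (forall v, exists q, is_path v q h) ->
  (forall J, two_sided_ideal J -> J (V h) -> forall v, J (V v)) ->
  purely_infinite_simple (LPA K E).
Proof.
move=> gh fg hfp to_h gen; have fh : src f = h by case: hfp.
have red x (xn0 : x <> 0) := lpa_reduction fh gh fg to_h xn0.
split; first exact: lpa_has_local_units.
  split; first by exists (V h), (V h); rewrite lpa_vtx_id; exact: lpa_vtx_neq0.
  move=> J JJ; have [[x [Jx xn0]]|J0] := pselect (exists x, J x /\ x <> 0).
    right; apply: lpa_ideal_full => //; apply: gen => //.
    have [a [b <-]] := red x xn0.
    by apply: (proj2 (proj1 JJ)); apply: (proj2 JJ).
  left; apply/seteqP; split=> [x Jx|_ ->]; last exact: (proj1 (proj1 (proj1 JJ))).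
  by apply: contrapT => xn0; apply: J0; exists x.
have ts := lpa_gpath_pathK K hfp.
apply: (@right_ideal_infinite_idempotent _ (V h) (P (f :: p) h) (Q (f :: p) h)) => //.
- exact: lpa_vtx_id.
- by rewrite (lpa_vtx_path _ _ hfp) eqxx.
- exact: lpa_path_vtx.
- exact: lpa_vtx_gpath.
- by rewrite (lpa_gpath_vtx _ _ hfp) eqxx.
(* Compressing by [g] kills the path, which begins with [f], but sends [h] to the nonzero vertex
   [tgt g]. *)
move=> /(congr1 (fun x => lpa_ghost K g ** x ** lpa_edge K g)) /=.
rewrite -!rngmulA (rngmulA (lpa_ghost K g)) !lpa_ghost_edge.
case: eqP => [gf|_]; first by case: fg.
rewrite rngmul0r lpa_vtx_edge gh eqxx lpa_ghost_edge eqxx => /esym.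
exact: lpa_vtx_neq0.
Qed.

(** A monomial in the corner between [u] in [A] and [v] in [B] would pass through a vertex reachable
    from both, so the corner is zero. *)
Lemma vertex_ideal_orthogonal (A B : set (vertex E)) :
  (forall u v p q w, A u -> B v -> is_path u p w -> is_path v q w -> False) ->
  forall x y, vertex_ideal K A x -> vertex_ideal K B y -> x ** y = 0.
Proof.
move=> AB x y Ax By.
(* The free middle factor [z] makes the annihilator a two-sided ideal. *)
have xB v : B v -> vertex_ideal K A `<=` [set x | forall z, x ** z ** V v = 0].
  move=> Bv; apply: ideal_gen_sub => [|_ [u Au <-] z /=].
    split; first split; first split.
    - by move=> z; rewrite !rngmul0r.
    - by move=> a b Ja Jb z; rewrite !rngmulBl Ja Jb subr0.
    - by move=> a r Ja z; rewrite -(rngmulA a).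
    - by move=> a r Ja z; rewrite -!rngmulA (rngmulA a) Ja rngmulr0.
  have [n] := lpa_span_corner z u v.
  elim=> [//|k _ p q w {}z -> up vq _ _ ->].
  by case: (AB u v p q w).
suff By0 : vertex_ideal K B `<=`
    [set y | forall x, vertex_ideal K A x -> x ** y = 0] by exact: By0 Ax.
have [[_ AR] _] := ideal_gen_ideal (V @` A).
apply: ideal_gen_sub => [|_ [v Bv <-] a Aa /=].
  split; first split; first split.
  - by move=> a _; rewrite rngmulr0.
  - by move=> b c Jb Jc a Aa; rewrite rngmulBr Jb // Jc // subr0.
  - by move=> b r Jb a Aa; rewrite rngmulA Jb // rngmul0r.
  - by move=> b r Jb a Aa; rewrite rngmulA; apply: Jb; exact: AR.
(* A local unit of [a] is taken as the middle factor. *)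
have [s us [_ as_]] := lpa_unitP a.
by rewrite -as_; exact: xB Bv _ Aa _.
Qed.

End LeavittIdeals.

(** * The hedgehog graph of a hereditary set *)

Section Hedgehog.
Variables (E : graph) (H : set (vertex E)).
Hypothesis hereditaryH : forall e : edge E, H (src e) -> H (tgt e).
Implicit Types (u v w : vertex E) (e : edge E) (p q r : seq (edge E)).

Definition entering_path (a : seq (edge E) * vertex E) :=
  [/\ exists u, is_path u a.1 a.2, H a.2 & forall e, e \in a.1 -> ~ H (src e)].

(* The vertices of the hedgehog graph are the paths meeting [H] only at their
   end; the trivial ones stand for the vertices of [H]. *)
Definition hedgehog_vertex := {a | entering_path a}.

(** The first summand gives the edges of [E] inside [H], the second the single edge leaving each
    nontrivial entering path. *)
Definition hedgehog_edge :=
  ({e | H (src e)} + {a : hedgehog_vertex | (sval a).1 <> [::]})%type.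

Lemma entering_trivial w : H w -> entering_path ([::], w).
Proof. by move=> Hw; split=> //=; exists w. Qed.

Definition hedgehog_trivial w (Hw : H w) : hedgehog_vertex :=
  exist _ _ (entering_trivial Hw).

Lemma entering_end (a : hedgehog_vertex) : H (sval a).2.
Proof. by case: (svalP a). Qed.

Definition hedgehog_src (x : hedgehog_edge) : hedgehog_vertex :=
  match x with
  | inl e => hedgehog_trivial (svalP e)
  | inr a => sval a
  end.

Definition hedgehog_tgt (x : hedgehog_edge) : hedgehog_vertex :=
  match x with
  | inl e => hedgehog_trivial (hereditaryH (svalP e))
  | inr a => hedgehog_trivial (entering_end (sval a))
  end.

Definition hedgehog := Graph hedgehog_src hedgehog_tgt.

Lemma hedgehog_trivial_eq u v (Hu : H u) (Hv : H v) :
  u = v -> hedgehog_trivial Hu = hedgehog_trivial Hv.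
Proof. by move=> uv; apply: eq_exist; rewrite uv. Qed.

Lemma hedgehog_lift_path u p w (Hu : H u) (Hw : H w) : is_path u p w ->
  exists p' : seq (edge hedgehog), @is_path hedgehog (hedgehog_trivial Hu) p' (hedgehog_trivial Hw).
Proof.
elim: p u Hu => [|e p IH] u Hu /=.
  by move=> uw; exists [::]; apply: hedgehog_trivial_eq.
move=> [eu pw]; have He : H (src e) by rewrite eu.
have [p' p'P] := IH _ (hereditaryH He) pw.
exists (inl (exist _ e He) :: p'); split;
  rewrite /= -/hedgehog; first exact: hedgehog_trivial_eq.
rewrite (_ : hedgehog_trivial _ = hedgehog_trivial (hereditaryH He)) //.
exact: hedgehog_trivial_eq.
Qed.

Lemma hedgehog_vertex_cases (a : hedgehog_vertex) :
  (exists w (Hw : H w), a = hedgehog_trivial Hw) \/ (sval a).1 <> [::].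
Proof.
case: a => -[[|e p] w] aP; last by right.
by left; exists w; have Hw := entering_end (exist _ _ aP); exists Hw; apply: eq_exist.
Qed.

(** * The map from the hedgehog algebra to the algebra of [E] *)

Section Map.
Variable K : fieldType.
Local Notation V := (lpa_vtx K).
Local Notation P := (lpa_path K).
Local Notation Q := (lpa_gpath K).
Local Notation D := (lpa_edge K).
Local Notation G := (lpa_ghost K).

Lemma entering_path_cons e p w :
  entering_path (e :: p, w) -> is_path (tgt e) p w /\ entering_path (p, w).
Proof.
move=> [[u [_ /= pw]] Hw Hp]; split=> //; split=> //; first by exists (tgt e).
by move=> e' e'p; apply: Hp; rewrite inE e'p orbT.
Qed.

(** Entering paths meet [H] only at the end, so none is a proper prefix of another; distinct ones
    either start apart or diverge. *)
Lemma entering_gpath_path p w p' w' :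
  entering_path (p, w) -> entering_path (p', w') ->
  (p, w) <> (p', w') -> Q p w ** P p' w' = 0.
Proof.
elim: p p' => [|e p IH] [|e' p'] pE p'E ne /=.
- rewrite lpa_vtxM; case: eqP => // ww'; by case: ne; rewrite ww'.
- case: p'E => _ _ /(_ e'); rewrite inE eqxx => /(_ isT) nH.
  rewrite rngmulA lpa_vtx_edge; case: eqP => [we|_]; last by rewrite rngmul0r.
  by case: nH; rewrite /= -we; case: pE.
- case: pE => _ _ /(_ e); rewrite inE eqxx => /(_ isT) nH.
  rewrite -rngmulA lpa_ghost_vtx; case: eqP => [we|_]; last by rewrite rngmulr0.
  by case: nH; rewrite /= -we; case: p'E.
have [pw {}pE] := entering_path_cons pE.
have [pw' {}p'E] := entering_path_cons p'E.
rewrite -rngmulA (rngmulA (G e)) lpa_ghost_edge.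
case: eqP => [ee'|_]; last by rewrite rngmul0r rngmulr0.
subst e'; rewrite (lpa_vtx_path _ _ pw') eqxx IH // => -[pp' ww'].
by case: ne; rewrite pp' ww'.
Qed.

(** An entering path is sent to its range projection as a vertex and to itself as an edge; edges
    inside [H] are kept. *)
Definition hedgehog_gen (x : lpa_gen hedgehog) : LPA K E :=
  match x with
  | gvertex a => P (sval a).1 (sval a).2 ** Q (sval a).1 (sval a).2
  | gedge (inl e) => D (sval e)
  | gedge (inr a) => P (sval (sval a)).1 (sval (sval a)).2
  | gghost (inl e) => G (sval e)
  | gghost (inr a) => Q (sval (sval a)).1 (sval (sval a)).2
  end.

Lemma entering_gpathK (a : hedgehog_vertex) :
  Q (sval a).1 (sval a).2 ** P (sval a).1 (sval a).2 = V (sval a).2.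
Proof. by case: (svalP a) => -[u up] _ _; exact: lpa_gpath_pathK up. Qed.

Lemma hedgehog_gpath_path (a b : hedgehog_vertex) :
  Q (sval a).1 (sval a).2 ** P (sval b).1 (sval b).2 =
  if pselect (a = b) then V (sval a).2 else 0.
Proof.
case: pselect => [ab /=|ab]; first by rewrite -ab entering_gpathK.
case: a b ab => -[p w] aP [[p' w'] bP] ab; apply: entering_gpath_path => // E'.
by apply: ab; apply: eq_exist.
Qed.

(** The edge [e0] is a default value for the added edges, none of which starts at a trivial path. *)
Lemma hedgehog_out_trivial w (Hw : H w) (e0 : edge E) :
  set_bij (@out_edges hedgehog (hedgehog_trivial Hw)) (@out_edges E w)
    (fun x => if x is inl e then sval e else e0).
Proof.
have bad a : ~ @out_edges hedgehog (hedgehog_trivial Hw) (inr a).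
  case: a => a an aE; have {}aE : a = hedgehog_trivial Hw := aE.
  by apply: (an); rewrite aE.
split.
- by move=> [e|a] => [/(congr1 (fun b => (sval b).2))|/bad].
- move=> [e|a] [e'|a'] /set_mem aE /set_mem a'E;
    [|by case: (bad _ a'E)|by case: (bad _ aE)|by case: (bad _ aE)].
  by case: e e' aE a'E => [e He] [e' He'] /= _ _ ee'; congr inl; apply: eq_exist.
- move=> e1 /= ew; have He : H (src e1) by rewrite ew.
  by exists (inl (exist _ e1 He)); first exact: hedgehog_trivial_eq.
Qed.

Lemma hedgehog_out_entering (a : hedgehog_vertex) (an : (sval a).1 <> [::]) :
  @out_edges hedgehog a = [set (inr (exist _ a an) : edge hedgehog)].
Proof.
apply/seteqP; split=> [[e|[b bn]] /= bE|_ -> //].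
  by case: an; rewrite -bE.
by congr inr; apply: eq_exist.
Qed.

Lemma hedgehog_gen_rel x y : @lpa_rel K hedgehog x y ->
  term_eval hedgehog_gen x = term_eval hedgehog_gen y.
Proof.
have PQP (a : hedgehog_vertex) : P (sval a).1 (sval a).2 ** Q (sval a).1 (sval a).2 **
    P (sval a).1 (sval a).2 = P (sval a).1 (sval a).2.
  by rewrite -rngmulA entering_gpathK lpa_path_vtx.
have QPQ (a : hedgehog_vertex) : Q (sval a).1 (sval a).2 ** (P (sval a).1 (sval a).2 **
    Q (sval a).1 (sval a).2) = Q (sval a).1 (sval a).2.
  by rewrite rngmulA entering_gpathK lpa_vtx_gpath.
case=> {x y} [a b|[e|[a an]]|[e|[a an]]|[e|[a an]]|[e|[a an]]|x y|a ra].
- rewrite /= -rngmulA (rngmulA (Q (sval a).1 _)) hedgehog_gpath_path.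
  case: eqP => [->|ab]; case: pselect => //= _; last by rewrite rngmul0r rngmulr0.
  by rewrite lpa_vtx_gpath.
- by rewrite /= lpa_vtx_id lpa_vtx_edge eqxx.
- exact: PQP.
- by rewrite /= lpa_vtx_id lpa_edge_vtx eqxx.
- by rewrite /= lpa_vtx_id lpa_path_vtx.
- by rewrite /= lpa_vtx_id lpa_vtx_ghost eqxx.
- by rewrite /= lpa_vtx_id lpa_vtx_gpath.
- by rewrite /= lpa_vtx_id lpa_ghost_vtx eqxx.
- exact: QPQ.
- have trivE e (He : H (src e)) : D e = P [::] (src e) ** D e.
    by rewrite /= lpa_vtx_edge eqxx.
  have trivG e (He : H (src e)) : G e = G e ** Q [::] (src e).
    by rewrite /= lpa_ghost_vtx eqxx.
  case: x y => [[e He]|[a an]] [[e' He']|[b bn]] /=.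
  + rewrite lpa_ghost_edge; case: (e =P e') => [ee'|ee']; case: eqP => //=.
    * by move=> _; rewrite lpa_vtx_id.
    * by case; congr inl; apply: eq_exist.
    * by case.
  + case: eqP => // _; rewrite (trivG _ He) -rngmulA.
    have /= -> := hedgehog_gpath_path (hedgehog_trivial He) b.
    by case: pselect => [ab|_] /=; [case: (bn); rewrite -ab|rewrite rngmulr0].
  + case: eqP => // _; rewrite (trivE _ He') rngmulA.
    have /= -> := hedgehog_gpath_path a (hedgehog_trivial He').
    by case: pselect => [ab|_] /=; [case: (an); rewrite ab|rewrite rngmul0r].
  + rewrite hedgehog_gpath_path; case: pselect => [ab|ab]; case: eqP => //= E'.
    * by rewrite lpa_vtx_id.
    * by case: E'; congr inr; apply: eq_exist.
    * by case: E' => ab'; case: ab.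
(* The relation at a regular vertex. A nontrivial entering path emits one edge, so the sum has one
   term; at a vertex of [H] the sum is reindexed to the one in [E]. *)
rewrite term_eval_sum [LHS]/=.
have [[w [Hw aE]]|an] := hedgehog_vertex_cases a; last first.
  by rewrite (hedgehog_out_entering an) fset_set1 big_seq_fset1.
subst a; case: ra => fa [[e0|[a an]] a0]; last first.
  have aw : a = hedgehog_trivial Hw := a0.
  by case: (an); rewrite aw.
have bij := hedgehog_out_trivial Hw (sval e0).
have rw : regular w.
  have [bf bi bs] := bij; split; last by exists (sval e0); exact: bf a0.
  by apply: sub_finite_set bs _; exact: finite_image.
rewrite lpa_vtx_id (lpa_vtx_sum K rw).
rewrite -!fsbig_finite //; last exact: (proj1 rw).
rewrite (reindex_fsbig _ _ _ _ bij); apply: eq_fsbigr => x /set_mem.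
case: x => [e|[a an]] // aE; have aw : a = hedgehog_trivial Hw := aE.
by case: (an); rewrite aw.
Qed.

End Map.
End Hedgehog.

(** * The hedgehog algebra is purely infinite simple and isomorphic to the ideal *)

Section HedgehogAlgebra.
Variables (K : fieldType) (E : graph) (H : set (vertex E)).
Hypothesis hereditaryH : forall e : edge E, H (src e) -> H (tgt e).
Hypothesis connectedH : forall u w, H u -> H w -> exists p, is_path u p w.
Variables (h : vertex E) (f g : edge E) (p0 : seq (edge E)).
Hypotheses (Hh : H h) (src_g : src g = h) (neq_fg : f <> g).
Hypothesis closed_f : is_path h (f :: p0) h.

Local Notation F := (hedgehog hereditaryH).
Local Notation V := (lpa_vtx K).
Local Notation P := (lpa_path K).
Local Notation Q := (lpa_gpath K).
Local Notation D := (lpa_edge K).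
Local Notation G := (lpa_ghost K).

Lemma hedgehog_connected (a : vertex F) :
  exists p : seq (edge F), is_path a p (hedgehog_trivial Hh : vertex F).
Proof.
have [[w [Hw ->]]|an] := hedgehog_vertex_cases a.
  have [p wp] := connectedH Hw Hh.
  exact: (hedgehog_lift_path hereditaryH Hw Hh wp).
have [p wp] := connectedH (entering_end a) Hh.
have [p' wp'] := hedgehog_lift_path hereditaryH (entering_end a) Hh wp.
by exists ((inr (exist _ a an) : edge F) :: p').
Qed.

(** Vertices of [H] are reached from [h]. An added source emits a single edge [x], so it equals
    [D x ** G x] and lies in the ideal because the target of [x] does. *)
Lemma hedgehog_ideal_vtx (J : set (LPA K F)) : two_sided_ideal J ->
  J (V (hedgehog_trivial Hh : vertex F)) -> forall a, J (V a).
Proof.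
move=> JJ Jh a.
have Jtriv w (Hw : H w) : J (V (hedgehog_trivial Hw : vertex F)).
  have [p hp] := connectedH Hh Hw.
  have [p' hp'] := hedgehog_lift_path hereditaryH Hh Hw hp.
  exact: lpa_ideal_path JJ hp' Jh.
have [[w [Hw ->]]|an] := hedgehog_vertex_cases a; first exact: Jtriv.
pose x : edge F := inr (exist _ a an).
have ra : @regular F a.
  by split; rewrite (hedgehog_out_entering _ an); [exact: finite_set1|exists x].
rewrite (lpa_vtx_sum K ra) (hedgehog_out_entering _ an) fset_set1 big_seq_fset1.
have <- : D x ** V (tgt x) = D x by rewrite lpa_edge_vtx eqxx.
by apply: (proj2 (proj1 JJ)); apply: (proj2 JJ); exact: Jtriv.
Qed.

Lemma hedgehog_purely_infinite_simple : purely_infinite_simple (LPA K F).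
Proof.
have [fh p0P] := closed_f.
have Hf : H (src f) by rewrite fh.
have Hg : H (src g) by rewrite src_g.
have [p p0P'] := hedgehog_lift_path hereditaryH (hereditaryH Hf) Hh p0P.
apply: (@lpa_purely_infinite_simple K F (hedgehog_trivial Hh)
  (inl (exist _ f Hf)) (inl (exist _ g Hg)) p).
- exact: hedgehog_trivial_eq.
- by case.
- split; first exact: hedgehog_trivial_eq.
  have fT : @tgt F (inl (exist _ f Hf)) = hedgehog_trivial (hereditaryH Hf).
    exact: hedgehog_trivial_eq.
  by rewrite fT.
- exact: hedgehog_connected.
- exact: hedgehog_ideal_vtx.
Qed.

(** Injectivity comes from simplicity, as [h] is not in the kernel. Surjectivity holds because the
    image is a two-sided ideal containing the vertices of [H]. *)
Lemma hedgehog_iso : ralg_iso_onto (LPA K F) (vertex_ideal K H).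
Proof.
have [phi [phiM phiE]] := presented_lift (@hedgehog_gen_rel _ _ hereditaryH K).
exists phi; split=> //.
have phiV (a : vertex F) : phi (V a) = P (sval a).1 (sval a).2 ** Q (sval a).1 (sval a).2.
  exact: phiE.
have phi0 : phi 0 = 0 by exact: linear0.
have phiD x y : phi (x + y) = phi x + phi y by exact: linearD.
have phiB x y : phi (x - y) = phi x - phi y by exact: linearB.
have phiZ a x : phi (a *: x) = a *: phi x by exact: linearZ.
have phi_triv w (Hw : H w) : phi (V (hedgehog_trivial Hw : vertex F)) = V w.
  by rewrite phiV /= lpa_vtx_id.
have [_ [_ simpleF] _] := hedgehog_purely_infinite_simple.
have phi_inj : injective phi.
  have kI : two_sided_ideal [set x | phi x = 0].
    split; first split; first split=> //=.
    - by move=> x y /= x0 y0; rewrite phiB x0 y0 subr0.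
    - by move=> x r /= x0; rewrite phiM x0 rngmul0r.
    - by move=> x r /= x0; rewrite phiM x0 rngmulr0.
  have [k0|kT] := simpleF _ kI.
  - move=> x y xy; apply/eqP; rewrite -subr_eq0; apply/eqP.
    have : [set x | phi x = 0] (x - y) by rewrite /= phiB xy subrr.
    by rewrite k0.
  - have : [set x | phi x = 0] (V (hedgehog_trivial Hh : vertex F)) by rewrite kT.
    by rewrite /= phi_triv => /lpa_vtx_neq0.
have phi_path (a : vertex F) : range phi (P (sval a).1 (sval a).2).
  have [[w [Hw ->]]|an] := hedgehog_vertex_cases a.
    by exists (V (hedgehog_trivial Hw : vertex F)); rewrite ?phi_triv.
  by exists (D (inr (exist _ a an) : edge F)) => //; exact: phiE.
have phi_gpath (a : vertex F) : range phi (Q (sval a).1 (sval a).2).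
  have [[w [Hw ->]]|an] := hedgehog_vertex_cases a.
    by exists (V (hedgehog_trivial Hw : vertex F)); rewrite ?phi_triv.
  by exists (G (inr (exist _ a an) : edge F)) => //; exact: phiE.
have phi_edge e (He : H (src e)) : range phi (D e).
  by exists (D (inl (exist _ e He) : edge F)) => //; exact: phiE.
have phi_ghost e (He : H (src e)) : range phi (G e).
  by exists (G (inl (exist _ e He) : edge F)) => //; exact: phiE.
have range0 : range phi 0 by exists 0.
have rangeD x y : range phi x -> range phi y -> range phi (x + y).
  by move=> [a _ <-] [b _ <-]; exists (a + b).
have rangeZ k x : range phi x -> range phi (k *: x).
  by move=> [a _ <-]; exists (k *: a).
have rangeM x y : range phi x -> range phi y -> range phi (x ** y).
  by move=> [a _ <-] [b _ <-]; exists (a ** b).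
have range_sum (I : eqType) (r : seq I) (A : I -> LPA K E) :
    (forall i, range phi (A i)) -> range phi (\sum_(i <- r) A i).
  by move=> rA; apply: (big_ind (range phi)).
(* Elements of the image are fixed by sums of images of vertices, so it suffices to multiply these.
   They factor as a path times its ghost, which reduces the check to products with entering
   paths. *)
have phi_unit x : range phi x -> exists s,
    x = \sum_(a <- s) phi (V (a : vertex F)) ** x /\
    x = \sum_(a <- s) x ** phi (V (a : vertex F)).
  move=> [y _ <-]; have [s us [sy ys]] := lpa_unitP y; exists s.
  rewrite -rngmul_suml -rngmul_sumr -raddf_sum -!phiM.
  by rewrite -/(lpa_unit K s) sy ys.
have mull_path (x : LPA K E) (a : vertex F) :
    range phi (x ** P (sval a).1 (sval a).2) -> range phi (x ** phi (V a)).
  by rewrite phiV rngmulA => xP; exact: rangeM.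
have mulr_path (x : LPA K E) (a : vertex F) :
    range phi (Q (sval a).1 (sval a).2 ** x) -> range phi (phi (V a) ** x).
  by rewrite phiV -rngmulA => Qx; exact: rangeM.
have range_mull x y : range phi y -> range phi (x ** y).
  suff gen z : (forall a, range phi (z ** phi (V a))) ->
      forall y, range phi y -> range phi (z ** y).
    elim/lpa_ind: x y => [v|e|e||x x' IH IH'|k x IH|x x' IH IH'] y yr.
    - apply: gen yr => a; apply: mull_path.
      have [[u up] _ _] := svalP a.
      by rewrite (lpa_vtx_path _ _ up); case: ifP.
    - apply: gen yr => a; apply: mull_path.
      have [[u up] Hw Hp] := svalP a.
      have := lpa_vtx_path K u up; rewrite eqxx => <-.
      rewrite rngmulA lpa_edge_vtx; case: eqP => [ue|_]; last by rewrite rngmul0r.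
      (* If [e] starts outside [H], prepending it gives another entering path; otherwise both
         factors are already in the image. *)
      have [He|nHe] := pselect (H (src e)).
        by apply: rangeM; [exact: phi_edge|exact: phi_path].
      have aeP : entering_path H (e :: (sval a).1, (sval a).2).
        split=> //; first by exists (src e); rewrite /= -ue.
        by move=> e'; rewrite inE => /predU1P[->//|/Hp].
      exact: (phi_path (exist _ _ aeP)).
    - apply: gen yr => a; apply: mull_path.
      case: a => -[[|e' p] w] aP /=.
        rewrite lpa_ghost_vtx; case: eqP => // we.
        by apply: phi_ghost; rewrite -we; case: (aP).
      have [pw pP] := entering_path_cons aP.
      rewrite rngmulA lpa_ghost_edge; case: eqP => [->|_]; last by rewrite rngmul0r.
      rewrite (lpa_vtx_path _ _ pw) eqxx; exact: (phi_path (exist _ _ pP)).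
    - by rewrite rngmul0r.
    - by rewrite rngmulDl; apply: rangeD; [exact: IH|exact: IH'].
    - by rewrite -rngscaleAl; apply/rangeZ/IH.
    - by rewrite -rngmulA; apply/IH/IH'.
  move=> zr {}y yr; have [s [-> _]] := phi_unit y yr.
  by rewrite rngmul_sumr; apply: range_sum => a; rewrite rngmulA; exact: rangeM.
have range_mulr x y : range phi y -> range phi (y ** x).
  suff gen z : (forall a, range phi (phi (V a) ** z)) ->
      forall y, range phi y -> range phi (y ** z).
    elim/lpa_ind: x y => [v|e|e||x x' IH IH'|k x IH|x x' IH IH'] y yr.
    - apply: gen yr => a; apply: mulr_path.
      have [[u up] _ _] := svalP a.
      by rewrite (lpa_gpath_vtx _ _ up); case: ifP.
    - apply: gen yr => a; apply: mulr_path.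
      case: a => -[[|e' p] w] aP /=.
        rewrite lpa_vtx_edge; case: eqP => // we.
        by apply: phi_edge; rewrite -we; case: (aP).
      have [pw pP] := entering_path_cons aP.
      rewrite -rngmulA lpa_ghost_edge; case: eqP => [->|_]; last by rewrite rngmulr0.
      rewrite (lpa_gpath_vtx _ _ pw).
      by case: ifP => // _; exact: (phi_gpath (exist _ _ pP)).
    - apply: gen yr => a; apply: mulr_path.
      have [[u up] Hw Hp] := svalP a.
      have := lpa_gpath_vtx K u up; rewrite eqxx => <-.
      rewrite -rngmulA lpa_vtx_ghost; case: eqP => [ue|_]; last by rewrite rngmulr0.
      have [He|nHe] := pselect (H (src e)).
        by apply: rangeM; [exact: phi_gpath|exact: phi_ghost].
      have aeP : entering_path H (e :: (sval a).1, (sval a).2).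
        split=> //; first by exists (src e); rewrite /= -ue.
        by move=> e'; rewrite inE => /predU1P[->//|/Hp].
      exact: (phi_gpath (exist _ _ aeP)).
    - by rewrite rngmulr0.
    - by rewrite rngmulDr; apply: rangeD; [exact: IH|exact: IH'].
    - by rewrite -rngscaleAr; apply/rangeZ/IH.
    - by rewrite rngmulA; apply/IH'/IH.
  move=> zr {}y yr; have [s [_ ->]] := phi_unit y yr.
  by rewrite rngmul_suml; apply: range_sum => a; rewrite -rngmulA; exact: rangeM.
split.
- move=> x _ /=.
  have [[[I0 IB] IR] IL] := ideal_gen_ideal (V @` H).
  (* The preimage of the vertex ideal is an ideal containing [h], hence everything. *)
  suff kT : [set x | vertex_ideal K H (phi x)] = setT.
    by have : [set x | vertex_ideal K H (phi x)] x by rewrite kT.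
  have kI : two_sided_ideal [set x | vertex_ideal K H (phi x)].
    split; first split; first split=> /=.
    + by rewrite phi0.
    + by move=> a b Ia Ib; rewrite phiB; exact: IB.
    + by move=> a r Ia /=; rewrite phiM; exact: IR.
    + by move=> a r Ia /=; rewrite phiM; exact: IL.
  apply: lpa_ideal_full => // a; apply: hedgehog_ideal_vtx => //=.
  by rewrite phi_triv; apply: sub_ideal_gen; exists h.
- by move=> x y _ _; exact: phi_inj.
- apply: ideal_gen_sub => [|_ [w Hw <-]]; last first.
    by exists (V (hedgehog_trivial Hw : vertex F)).
  split; first split; first split=> //.
  + by move=> x y xr yr; rewrite -scaleN1r; apply: rangeD => //; exact: rangeZ.
  + by move=> x r; exact: range_mulr.
  + by move=> x r; exact: range_mull.
Qed.

End HedgehogAlgebra.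

(** * Direct sums of orthogonal ideals with local units *)

Section OrthogonalSum.
Variables (R : rngType) (I : choiceType) (X : set I) (Y : I -> set R).
Hypothesis orthogonal : forall i j x y, X i -> X j -> i <> j ->
  ideal_gen (Y i) x -> ideal_gen (Y j) y -> x ** y = 0.
Hypothesis local_units : forall i x, X i -> ideal_gen (Y i) x ->
  exists2 e, ideal_gen (Y i) e & x ** e = x.

(** A local unit of one component annihilates all others, which gives uniqueness. The sums form an
    ideal, which gives existence. *)
Lemma internal_direct_sum_orthogonal :
  internal_direct_sum X (fun i => ideal_gen (Y i)) (ideal_gen (\bigcup_(i in X) Y i)).
Proof.
have YJ i : X i -> ideal_gen (Y i) `<=` ideal_gen (\bigcup_(i in X) Y i).
  move=> Xi; apply: ideal_gen_sub; first exact: ideal_gen_ideal.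
  by move=> y Yy; apply: sub_ideal_gen; exists i.
(* Any finite index set that contains the support may be used, so two families can be summed over a
   common one. *)
have sumE (f : I -> R) (A : set I) : finite_set A -> A `<=` X ->
    (forall i, ~ A i -> f i = 0) ->
    \sum_(i \in X) f i = \sum_(i <- fset_set A) f i.
  move=> fA AX f0; rewrite -fsbig_finite //; apply/esym/fsbig_widen => //.
  by move=> i [_ /f0].
have supp (f : I -> R) : (forall i, ~ X i -> f i = 0) -> [set i | f i <> 0] `<=` X.
  by move=> f0 i /= fi; apply: contrapT => /f0.
have supp0 (f : I -> R) i : ~ [set i | f i <> 0] i -> f i = 0.
  by move=> /contrapT.
split.
- move=> f [ff fF f0] /=; rewrite (sumE f _ ff (supp _ f0) (@supp0 f)).
  apply: additive_subgroup_sum; first exact: (proj1 (proj1 (ideal_gen_ideal _))).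
  move=> i; rewrite in_fset_set // inE => /(supp _ f0) Xi.
  exact: YJ (fF i Xi).
- move=> f g /set_mem[ff fF f0] /set_mem[fg gF g0] fgE; apply/funext => i.
  have [Xi|nXi] := pselect (X i); last by rewrite f0 // g0.
  pose A := [set i | f i <> 0] `|` [set i | g i <> 0].
  have fA : finite_set A by rewrite finite_setU.
  have AX : A `<=` X by move=> j [/(supp _ f0)|/(supp _ g0)].
  have A0 j : ~ A j -> f j = 0 /\ g j = 0.
    by move=> /not_orP[/contrapT -> /contrapT ->].
  have [Ai|/A0[-> ->]//] := pselect (A i).
  have [_ Ffg] := proj1 (proj1 (ideal_gen_ideal (Y i))).
  (* Multiplying the difference of the two sums by [e] leaves only [f i - g i]. *)
  have [e Fe de] := local_units Xi (Ffg _ _ (fF i Xi) (gF i Xi)).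
  apply/eqP; rewrite -subr_eq0 -de; apply/eqP.
  have : (\sum_(j <- fset_set A) (f j - g j)) ** e = 0.
    rewrite sumrB -!(sumE _ A) // => [|j /A0[]|j /A0[]] //.
    by rewrite fgE subrr rngmul0r.
  rewrite rngmul_suml (bigD1_seq i) ?fset_uniq ?in_fset_set ?inE //= big_seq_cond.
  rewrite big1 ?addr0 // => j /andP[]; rewrite in_fset_set // inE => /AX Xj /eqP ji.
  have [_ Fj] := proj1 (proj1 (ideal_gen_ideal (Y j))).
  exact: orthogonal Xj Xi ji (Fj _ _ (fF j Xj) (gF j Xj)) Fe.
apply: ideal_gen_sub => [|y [i Xi Yy]]; last first.
  exists (fun j => if j == i then y else 0); last first.
    rewrite (sumE _ [set i] (finite_set1 i)) => [|_ -> //|j /eqP/negPf -> //].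
    by rewrite fset_set1 big_seq_fset1 eqxx.
  split.
  - apply: (sub_finite_set _ (finite_set1 i)) => j /=.
    by case: eqP.
  - move=> j Xj; case: eqP => [->|_]; first exact: sub_ideal_gen.
    by case: (ideal_gen_ideal (Y j)) => -[[]].
  - by move=> j nXj; case: eqP => // ji; case: nXj; rewrite ji.
(* Left and right multiplications both act componentwise, so one statement about additive maps
   covers both. *)
have mulP (h : R -> R) : h 0 = 0 -> {morph h : x y / x + y} ->
    (forall i x, X i -> ideal_gen (Y i) x -> ideal_gen (Y i) (h x)) ->
    forall f : I -> R, [/\ finite_set [set i | f i <> 0],
      forall i, X i -> ideal_gen (Y i) (f i) & forall i, ~ X i -> f i = 0] ->
    exists2 f' : I -> R, [/\ finite_set [set i | f' i <> 0],
      forall i, X i -> ideal_gen (Y i) (f' i) & forall i, ~ X i -> f' i = 0] &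
      \sum_(i \in X) f' i = h (\sum_(i \in X) f i).
  move=> h0 hD hY f [ff fF f0]; exists (fun i => h (f i)).
    split.
    - by apply: (sub_finite_set _ ff) => i /= hfi fi; apply: hfi; rewrite fi.
    - by move=> i Xi; apply: hY => //; exact: fF.
    - by move=> i /f0 ->.
  rewrite (sumE f _ ff (supp _ f0) (@supp0 f)) (sumE _ _ ff (supp _ f0)).
    by rewrite (big_morph h hD h0).
  by move=> i /supp0 ->.
split; first split; first split.
- exists (fun=> 0); last by rewrite fsbig1.
  split=> //; first by apply: (sub_finite_set _ (@finite_set0 I)) => i /=.
  by move=> i _; case: (ideal_gen_ideal (Y i)) => -[[]].
- move=> _ _ [f [ff fF f0] <-] [g [fg gF g0] <-].
  pose A := [set i | f i <> 0] `|` [set i | g i <> 0].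
  have fA : finite_set A by rewrite finite_setU.
  have AX : A `<=` X by move=> j [/(supp _ f0)|/(supp _ g0)].
  have A0 j : ~ A j -> f j = 0 /\ g j = 0.
    by move=> /not_orP[/contrapT -> /contrapT ->].
  exists (fun i => f i - g i).
    split.
    - by apply: (sub_finite_set _ fA) => i /= fgi; apply: contrapT => /A0[fi gi];
        apply: fgi; rewrite fi gi subr0.
    - move=> i Xi; have [_ Ffg] := proj1 (proj1 (ideal_gen_ideal (Y i))).
      exact: Ffg (fF i Xi) (gF i Xi).
    - by move=> i nXi; rewrite f0 // g0 // subr0.
  rewrite !(sumE _ A) //; first by rewrite sumrB.
  + by move=> i /A0[].
  + by move=> i /A0[].
  + by move=> i /A0[-> ->]; rewrite subr0.
- move=> _ r [f Hf <-].
  apply: (mulP (fun x => x ** r)) Hf; first exact: rngmul0r.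
  + by move=> x y; exact: rngmulDl.
  + by move=> i x _; case: (ideal_gen_ideal (Y i)) => -[_ +] _; apply.
- move=> _ r [f Hf <-].
  apply: (mulP (fun x => r ** x)) Hf; first exact: rngmulr0.
  + by move=> x y; exact: rngmulDr.
  + by move=> i x _; case: (ideal_gen_ideal (Y i)) => _; apply.
Qed.

End OrthogonalSum.

(** * Extreme cycles, their trees and their classes *)

Section ExtremeCycles.
Variable E : graph.
Implicit Types (u v w : vertex E) (e : edge E) (p q c d : seq (edge E)).

Lemma is_path_trans u v w : (exists p, is_path u p v) -> (exists p, is_path v p w) ->
  exists p, is_path u p w.
Proof.
by move=> [p up] [q vq]; exists (p ++ q); apply/is_path_cat; exists v.
Qed.

Lemma cycle_edge_path u c e : is_path u c u -> e \in c ->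
  (exists p, is_path u p (src e)) /\ exists p, is_path (src e) (e :: p) u.
Proof.
move=> uc ec; case/path.splitPr: ec uc => p q.
by move=> /is_path_cat[v up vq]; case: (vq) => -> _; split; [exists p|exists q].
Qed.

Lemma cycle_edge_closed c e : is_cycle c -> e \in c ->
  exists p, is_path (src e) (e :: p) (src e).
Proof.
move=> [_ [u uc] _] /(cycle_edge_path uc)[[p up] [q eq_]].
by exists (q ++ p); apply/(is_path_cat _ (e :: q)); exists u.
Qed.

Lemma cycle_connected c v w : is_cycle c -> cycle_vertices c v ->
  cycle_vertices c w -> exists p, is_path v p w.
Proof.
move=> [_ [u uc] _] /mapP[e ec ->] /mapP[e' e'c ->].
have [_ [p ep]] := cycle_edge_path uc ec.
have [ue' _] := cycle_edge_path uc e'c.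
by apply: is_path_trans ue'; exists (e :: p).
Qed.

(* A shortest nontrivial closed path at [w] does not repeat a vertex. *)
Lemma closed_path_cycle w p : is_path w p w -> p <> [::] ->
  exists2 c, is_cycle c & cycle_vertices c w.
Proof.
have [n] := ubnP (size p); elim: n p => // n IH p pn wp p0.
have [pu|] := boolP (uniq (map (@src E) p)).
  exists p; first by split=> //; exists w.
  by case: p wp p0 {pn pu} => // e p [<- _] _; rewrite /cycle_vertices /= inE eqxx.
(* If a source is repeated, the segment between its two occurrences can be cut out, and a shorter
   nontrivial closed path remains. *)
suff H q : ~~ uniq (map (@src E) q) -> exists p1 e p2 e' p3,
    q = p1 ++ e :: p2 ++ e' :: p3 /\ src e = src e'.
  move=> /H[p1 [e [p2 [e' [p3 [pE ee']]]]]]; apply: (IH (p1 ++ e' :: p3)).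
  - rewrite -ltnS; apply: leq_trans pn.
    by rewrite pE ltnS !size_cat ltn_add2l /= size_cat ltnS leq_addl.
  - move: wp; rewrite pE => /is_path_cat[v wp1 [ev /is_path_cat[v' _ [_ e'p]]]].
    by apply/is_path_cat; exists v => //; split; rewrite -?ee'.
  - by case: p1 {pE}.
elim: q => //= e q IHq; rewrite negb_and negbK => /orP[/mapP[e' e'q ee']|/IHq].
  by case/path.splitPr: e'q => p2 p3; exists [::], e, p2, e', p3.
by move=> [p1 [e1 [p2 [e2 [p3 [-> e12]]]]]]; exists (e :: p1), e1, p2, e2, p3.
Qed.

Lemma extreme_tree_return c u w : extreme_cycle c -> cycle_vertices c u ->
  tree (cycle_vertices c) w -> exists p, is_path w p u.
Proof.
move=> [cc _ cret] cu [v cv [p vp]]; have [q [u' [wq cu']]] := cret _ _ _ cv vp.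
by apply: (@is_path_trans _ u'); [exists q|exact: cycle_connected cu].
Qed.

Lemma tree_hereditary (A : set (vertex E)) v w :
  tree A v -> (exists p, is_path v p w) -> tree A w.
Proof. by move=> [u Au up] vw; exists u => //; exact: is_path_trans vw. Qed.

Lemma tree_self (A : set (vertex E)) : A `<=` tree A.
Proof. by move=> v Av; exists v => //; exists [::]. Qed.

Lemma extreme_tree_connected c u w : extreme_cycle c ->
  tree (cycle_vertices c) u -> tree (cycle_vertices c) w ->
  exists p, is_path u p w.
Proof.
move=> cE cu [v cv vw]; exact: is_path_trans (extreme_tree_return cE cv cu) vw.
Qed.

Lemma cycle_tgt d e : is_cycle d -> e \in d -> cycle_vertices d (tgt e).
Proof.
move=> [_ [u ud] _] ed; case/path.splitPr: ed ud => p q.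
move=> /is_path_cat[v up [ev eq_]]; apply/mapP => /=.
case: q eq_ => [eu|e' q [e't _]]; last first.
  by exists e'; rewrite // mem_cat !inE eqxx !orbT.
case: p up => [/= uv|e' p [e'u _]].
  by exists e; rewrite ?inE ?eqxx // ev -uv.
by exists e'; rewrite ?inE ?eqxx // e'u.
Qed.

(** A path from a cycle without exits never leaves it. The branching vertex would then lie on [d],
    and both edges would be the edge of [d] there. *)
Lemma cycle_exit_of_branching d v e e' : is_cycle d -> cycle_vertices d v ->
  (exists p, is_path v p (src e)) -> src e = src e' -> e <> e' ->
  exists e, is_exit d e.
Proof.
move=> dc dv [p vp] ee' ne; apply: contrapT => /forallNP nex.
have only e1 e2 : e1 \in d -> src e2 = src e1 -> e2 = e1.
  by move=> e1d e21; apply: contrapT => e2e1; case: (nex e2); exists e1.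
have /mapP[e1 e1d ee1] : cycle_vertices d (src e).
  elim: p v dv vp => [|e2 p IH] v dv /= => [<-//|[e2v]].
  apply: IH; move: dv => /mapP[e1 e1d ve1].
  by rewrite (only e1 e2) ?e2v //; exact: cycle_tgt.
by apply: ne; rewrite (only e1 e) // (only e1 e') // -ee'.
Qed.

(** A vertex [w] off [c] lies on a nontrivial closed path through [c], hence on a cycle [d]. This
    one reaches the branching vertex of [c], so it has an exit; it is returned to since the tree of
    [c] is strongly connected. *)
Lemma tree_extreme c w : extreme_cycle c -> tree (cycle_vertices c) w ->
  exists2 d, extreme_cycle d /\ ec_equiv c d & cycle_vertices d w.
Proof.
move=> cE cw; have [cw'|ncw] := pselect (cycle_vertices c w).
  by exists c => //; split=> //; exists w.
have [cc [e [e' e'c [ee' ne]]] cret] := cE.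
have cu : cycle_vertices c (src e') by apply/mapP; exists e'.
have [q wq] : exists q, is_path w q (src e').
  exact: extreme_tree_return cw.
have [p uw] : exists p, is_path (src e') p w.
  exact: (extreme_tree_connected cE (tree_self cu) cw).
have [d dc dw] : exists2 d, is_cycle d & cycle_vertices d w.
  apply: (@closed_path_cycle w (q ++ p)).
    by apply/is_path_cat; exists (src e').
  by case: q wq {uw} => //= wu; case: ncw; rewrite wu.
exists d => //; split; last by exists w.
have td v : cycle_vertices d v -> tree (cycle_vertices c) v.
  by move=> dv; apply: tree_hereditary cw _; exact: cycle_connected dw dv.
split=> //.
  by apply: (cycle_exit_of_branching dc dw _ ee' ne); exists q; rewrite ee'.
move=> v r x dv vr; have cx : tree (cycle_vertices c) x.
  by apply: tree_hereditary (td v dv) _; exists r.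
have [s xs] := extreme_tree_connected cE cx cw.
by exists s, w.
Qed.

Lemma class_vertices_tree c : extreme_cycle c ->
  class_vertices (ec_class c) = tree (cycle_vertices c).
Proof.
move=> cE; apply/seteqP; split=> [w [d [dE [u [cu du]]] dw]|w cw].
  by apply: tree_hereditary cu _; apply: cycle_connected du dw; case: dE.
by have [d [dE cd] dw] := tree_extreme cE cw; exists d.
Qed.

(** From the common vertex [v] every vertex of the tree of [c] can be reached, so [d] reaches
    whatever [c] reaches. *)
Lemma ec_class_sub c d v : extreme_cycle c -> extreme_cycle d ->
  tree (cycle_vertices c) v -> tree (cycle_vertices d) v ->
  ec_class c `<=` ec_class d.
Proof.
move=> cE dE cv dv x [xE [w [cw xw]]]; split=> //; exists w; split=> //.
by apply: tree_hereditary dv _; exact: extreme_tree_connected cE cv cw.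
Qed.

Lemma ec_class_eq c d v : extreme_cycle c -> extreme_cycle d ->
  tree (cycle_vertices c) v -> tree (cycle_vertices d) v ->
  ec_class c = ec_class d.
Proof.
by move=> cE dE cv dv; apply/seteqP; split; [exact: ec_class_sub cv dv|
  exact: ec_class_sub dv cv].
Qed.

Lemma P_ec_bigcup : P_ec E = \bigcup_(C in X_ec E) class_vertices C.
Proof.
apply/seteqP; split=> [v [c cE cv]|v [_ [c cE <-] [d [dE _] dv]]]; last by exists d.
exists (ec_class c); first by exists c.
by rewrite class_vertices_tree //; exact: tree_self.
Qed.

End ExtremeCycles.

(** * The ideal of one class, and the decomposition *)

Lemma vertex_ideal_extreme (K : fieldType) (E : graph) (C : set (seq (edge E))) :
  X_ec E C -> exists F : graph,
    ralg_iso_onto (LPA K F) (vertex_ideal K (class_vertices C)) /\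
    purely_infinite_simple (LPA K F).
Proof.
move=> [c cE <-]; rewrite class_vertices_tree //.
set H := tree _.
have hereditaryH e : H (src e) -> H (tgt e).
  by move=> He; apply: tree_hereditary He _; exists [:: e].
have connectedH u w : H u -> H w -> exists p, is_path u p w.
  exact: extreme_tree_connected.
(* An exit [g] and the edge [f] of [c] with the same source are the two branching edges; [f] lies on
   a closed path. *)
have [cc [g [f fc [gf ne]]] _] := cE.
have [p fp] := cycle_edge_closed cc fc.
have Hf : H (src f) by apply: tree_self; apply/mapP; exists f.
have ne' : f <> g by move=> fg; exact: ne.
exists (hedgehog hereditaryH); split.
  exact: (hedgehog_iso K hereditaryH connectedH Hf gf ne' fp).
exact: (hedgehog_purely_infinite_simple K hereditaryH connectedH Hf gf ne' fp).
Qed.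

Theorem proposition2p6 (K : fieldType) (E : graph) :
  internal_direct_sum (X_ec E)
    (fun C : set (seq (edge E)) => vertex_ideal K (class_vertices C))
    (vertex_ideal K (P_ec E)) /\
  (forall C : set (seq (edge E)), X_ec E C ->
     exists F : graph,
       ralg_iso_onto (LPA K F) (vertex_ideal K (class_vertices C)) /\
       purely_infinite_simple (LPA K F)).
Proof.
split; last exact: vertex_ideal_extreme.
rewrite /vertex_ideal P_ec_bigcup image_bigcup.
apply: internal_direct_sum_orthogonal.
- move=> _ _ x y [c cE <-] [d dE <-] cd.
  rewrite !class_vertices_tree //.
  (* A vertex reachable from both classes would make them equal. *)
  apply: vertex_ideal_orthogonal => u v p q w cu dv up vq; apply: cd.
  apply: (@ec_class_eq _ _ _ w) => //.
    by apply: tree_hereditary cu _; exists p.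
  by apply: tree_hereditary dv _; exists q.
- move=> C x /(vertex_ideal_extreme K)[F [[phi [phiM [phiI _ phiS]]] _]] Cx.
  (* Local units of the ideal are images of those of the isomorphic Leavitt path algebra. *)
  have [y _ <-] := phiS _ Cx; have [s us [_ ys]] := lpa_unitP y.
  by exists (phi (lpa_unit K s)); [exact: phiI|rewrite -phiM ys].
Qed.
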